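(* Let $\mathfrak g$ be a definable Lie ring of finite dimension. Then the Fitting ideal $F(\mathfrak g)$ is nilpotent and definable.
   Context: A first-order theory $T$ is finite-dimensional if there is a function $\dim$ from the class of all interpretable sets in models of $T$ to $\omega\cup\{-\infty\}$ such that, for every formula $\varphi(x,y)$, all interpretable sets $X,Y$ and every interpretable function $f:X\to Y$: (1) if $a,a'$ have the same type over $\emptyset$ then $\dim\varphi(x,a)=\dim\varphi(x,a')$; (2) $\dim\emptyset=-\infty$, and $\dim X=0$ iff $X$ is finite (nonempty); (3) $\dim(X\cup Y)=\max\{\dim X,\dim Y\}$; (4) if $\dim f^{-1}(y)\ge k$ for all $y\in Y$ then $\dim X\ge \dim Y+k$; (5) if $\dim f^{-1}(y)\le k$ for all $y\in Y$ then $\dim X\le\dim Y+k$. A definable Lie ring ''of finite dimension'' is one definable in (a model of) a finite-dimensional theory. A Lie ring is an abelian group $(\mathfrak g,+)$ with a biadditive antisymmetric bracket satisfying the Jacobi identity. The Fitting ideal $F(\mathfrak g)$ is the sum of all nilpotent ideals of $\mathfrak g$ (definable or not). *)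

(* Defs.v *)
From mathcomp Require Import all_boot all_algebra.
From mathcomp Require Import boolp classical_sets functions cardinality.

Set Implicit Arguments.
Unset Strict Implicit.
Unset Printing Implicit Defensive.

Import GRing.Theory.
Local Open Scope classical_set_scope.

(** * One-sorted first-order logic with equality *)

Record language := Language {
  fsym : nat -> Type;
  rsym : nat -> Type
}.

(* [term L n] and [formula L n] have their free variables among x_0,...,x_{n-1};
   variables are de Bruijn indices, so [FAll] binds variable 0 of its body. *)
Inductive term (L : language) (n : nat) : Type :=
| TVar of 'I_n
| TApp k of fsym L k & ('I_k -> term L n).

Inductive formula (L : language) : nat -> Type :=
| FBot n : formula L n
| FEq n : term L n -> term L n -> formula L n
| FRel n k : rsym L k -> ('I_k -> term L n) -> formula L n
| FImp n : formula L n -> formula L n -> formula L n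
| FAll n : formula L n.+1 -> formula L n.

Record structure (L : language) := Structure {
  carrier :> Type;
  carrier_inhabited : inhabited carrier;
  fint : forall k, fsym L k -> k.-tuple carrier -> carrier;
  rint : forall k, rsym L k -> k.-tuple carrier -> Prop
}.

Fixpoint eval L (M : structure L) n (v : n.-tuple M) (t : term L n) : M :=
  match t with
  | TVar i => tnth v i
  | TApp k f u => fint f [tuple eval v (u i) | i < k]
  end.

Fixpoint sat L (M : structure L) n (phi : formula L n) : n.-tuple M -> Prop :=
  match phi in formula _ n return n.-tuple M -> Prop with
  | FBot _ => fun=> False
  | FEq _ t u => fun v => eval v t = eval v u
  | FRel _ k r u => fun v => rint r [tuple eval v (u i) | i < k]
  | FImp _ p q => fun v => sat p v -> sat q v
  | FAll _ p => fun v => forall a : M, sat p (cons_tuple a v)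
  end.

Definition theory (L : language) := set (formula L 0).

Definition models L (M : structure L) (T : theory L) : Prop :=
  forall s, T s -> @sat L M 0 s (nil_tuple M).

(* The tuples may live in different structures. *)
Definition same_type L (M M' : structure L) k
    (a : k.-tuple M) (a' : k.-tuple M') : Prop :=
  forall phi : formula L k, sat phi a <-> sat phi a'.

(** * Definable and interpretable sets *)

Section Definable.
Variables (L : language) (M : structure L).

(* phi(M, a) *)
Definition defset n k (phi : formula L (n + k)) (a : k.-tuple M) :
  set (n.-tuple M) := [set x | sat phi (cat_tuple x a)].

(* Definable with parameters. *)
Definition definable n (D : set (n.-tuple M)) : Prop :=
  exists k (phi : formula L (n + k)) (a : k.-tuple M), D = defset phi a.

(* A binary relation between M^n and M^m, seen as a subset of M^(n+m). *)
Definition rel_set n m (R : n.-tuple M -> m.-tuple M -> Prop) :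
  set ((n + m).-tuple M) :=
  [set z | exists x y, R x y /\ z = cat_tuple x y].

(* The relation whose subset of M^(n+m) is Z. *)
Definition set_rel n m (Z : set ((n + m).-tuple M)) :
  n.-tuple M -> m.-tuple M -> Prop := fun x y => Z (cat_tuple x y).

Definition equiv_on n (D : set (n.-tuple M))
    (E : n.-tuple M -> n.-tuple M -> Prop) : Prop :=
  [/\ forall x, D x -> E x x,
      forall x y, D x -> D y -> E x y -> E y x &
      forall x y z, D x -> D y -> D z -> E x y -> E y z -> E x z].

(* D / E, as the set of E-classes in D. *)
Definition quot n (D : set (n.-tuple M))
    (E : n.-tuple M -> n.-tuple M -> Prop) : set (set (n.-tuple M)) :=
  [set C | exists2 x, D x & C = [set y | D y /\ E x y]].

(* A definable set D is covered as D / =, i.e. as a set of singletons. *)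
Definition interpretable n (X : set (set (n.-tuple M))) : Prop :=
  exists D E, [/\ definable D, definable (rel_set E), equiv_on D E
                & X = quot D E].

(* The values of f outside X are irrelevant. *)
Definition interpretable_fun n m (X : set (set (n.-tuple M)))
    (Y : set (set (m.-tuple M)))
    (f : set (n.-tuple M) -> set (m.-tuple M)) : Prop :=
  (forall C, X C -> Y (f C)) /\
  definable (rel_set (fun x y => exists C, [/\ X C, C x & f C y])).

End Definable.

(** * Finite-dimensional theories *)

(* omega with -oo added; [None] is -oo. *)
Definition dimension := option nat.

Definition dim_le (d e : dimension) : bool :=
  match d, e with
  | None, _ => true
  | Some _, None => false
  | Some m, Some n => (m <= n)%N
  end.

Definition dim_max (d e : dimension) : dimension :=
  if dim_le d e then e else d.

Definition dim_addn (d : dimension) (k : nat) : dimension :=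
  omap (fun m => (m + k)%N) d.

Record dimension_axioms L (T : theory L)
    (dim : forall (M : structure L) n, set (set (n.-tuple M)) -> dimension) :
    Prop := {
  (* The formula phi(x, y) has x ranging over imaginary elements: the interpretable
     set it defines is phi(M, a) / epsilon(M, a). *)
  dim_invariant : forall (M M' : structure L), models M T -> models M' T ->
    forall n k (phi : formula L (n + k)) (eps : formula L ((n + n) + k))
      (a : k.-tuple M) (a' : k.-tuple M'),
    same_type a a' ->
    equiv_on (defset phi a) (set_rel (defset eps a)) ->
    dim M n (quot (defset phi a) (set_rel (defset eps a))) =
    dim M' n (quot (defset phi a') (set_rel (defset eps a')));
  dim_empty : forall M : structure L, models M T ->
    forall n, dim M n set0 = None;
  dim_finite : forall M : structure L, models M T ->
    forall n (X : set (set (n.-tuple M))), interpretable X ->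
    dim M n X = Some 0%N <-> finite_set X /\ X !=set0;
  (* X and Y lie in a common interpretable set iff X `|` Y is interpretable. *)
  dim_union : forall M : structure L, models M T ->
    forall n (X Y : set (set (n.-tuple M))),
    interpretable X -> interpretable Y -> interpretable (X `|` Y) ->
    dim M n (X `|` Y) = dim_max (dim M n X) (dim M n Y);
  dim_fibre_ge : forall M : structure L, models M T ->
    forall n m (X : set (set (n.-tuple M))) (Y : set (set (m.-tuple M))) f k,
    interpretable X -> interpretable Y -> interpretable_fun X Y f ->
    (forall y, Y y -> dim_le (Some k) (dim M n (X `&` f @^-1` [set y]))) ->
    dim_le (dim_addn (dim M m Y) k) (dim M n X);
  dim_fibre_le : forall M : structure L, models M T ->
    forall n m (X : set (set (n.-tuple M))) (Y : set (set (m.-tuple M))) f k,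
    interpretable X -> interpretable Y -> interpretable_fun X Y f ->
    (forall y, Y y -> dim_le (dim M n (X `&` f @^-1` [set y])) (Some k)) ->
    dim_le (dim M n X) (dim_addn (dim M m Y) k)
}.

Definition finite_dimensional L (T : theory L) : Prop :=
  exists dim, @dimension_axioms L T dim.

(** * Lie rings *)

Local Open Scope ring_scope.

Record lieRing := LieRing {
  lie_sort :> zmodType;
  br : lie_sort -> lie_sort -> lie_sort;
  brDl : forall x y z, br (x + y) z = br x z + br y z;
  brDr : forall x y z, br x (y + z) = br x y + br x z;
  br_antisym : forall x y, br x y = - br y x;
  br_jacobi : forall x y z, br x (br y z) + br y (br z x) + br z (br x y) = 0
}.

Section Lie.
Variable g : lieRing.

Definition subgroup (A : set g) : Prop :=
  A 0 /\ (forall x y, A x -> A y -> A (x - y)).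

(* One-sided suffices, by antisymmetry. *)
Definition ideal (I : set g) : Prop :=
  subgroup I /\ (forall x y, I y -> I (br x y)).

Definition commutator (A B : set g) : set g :=
  smallest subgroup [set br x y | x in A & y in B].

(* [lcs I 0] is I itself. *)
Fixpoint lcs (I : set g) (k : nat) : set g :=
  if k is k'.+1 then commutator (lcs I k') I else I.

Definition nilpotent (I : set g) : Prop := exists k, lcs I k = [set 0].

Definition fitting : set g :=
  smallest subgroup (\bigcup_(I in [set I | ideal I /\ nilpotent I]) I).

End Lie.

Arguments fitting : clear implicits.

(* iota identifies g with a definable subset of M^n. *)
Record definable_lie L (M : structure L) (g : lieRing) n
    (iota : g -> n.-tuple M) : Prop := {
  iota_inj : injective iota;
  definable_carrier : definable (range iota);
  definable_add : definable
    [set cat_tuple (cat_tuple (iota x) (iota y)) (iota (x + y))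
      | x in [set: g] & y in [set: g]];
  definable_br : definable
    [set cat_tuple (cat_tuple (iota x) (iota y)) (iota (br x y))
      | x in [set: g] & y in [set: g]]
}.

(* Main.v *)
Require Import Defs.
From HB Require Import structures.
From mathcomp Require Import all_boot all_algebra.
From mathcomp Require Import boolp classical_sets functions cardinality filter.
From mathcomp Require Import zify.

(* Let [A] be a definable ideal. An infinite index makes the dimension drop, also in
   an ultrapower, so centralizers modulo [A] satisfy a uniform chain condition up to
   bounded index.
   Hence the almost centralizer of a definable subgroup modulo [A] is definable, and
   almost centralizing is a symmetric relation. If [A] has infinite index, then some
   finite subset of F(g) has a centralizer [K] modulo [A] that is almost centralized by
   F(g); it is infinite modulo [A], as the subset lies in a nilpotent ideal. Passing
   back and forth between [K] and its almost centralizer yields definable ideals [P],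
   almost containing F(g), and [B], infinite modulo [A], whose bracket is finite modulo
   [A] (as in B. H. Neumann's theorem on groups with bounded conjugacy classes).
   Iterating, the dimension bounds the number of steps and one obtains a definable
   nilpotent ideal [E] with F(g)/E finite. Then F(g) = E + I for some nilpotent ideal
   [I], hence F(g) is nilpotent, and it is a finite union of cosets of [E]. *)

Set Implicit Arguments.
Unset Strict Implicit.
Unset Printing Implicit Defensive.

Import GRing.Theory.
Local Open Scope ring_scope.
Local Open Scope classical_set_scope.

(** * Subgroups of finite index, nilpotent ideals *)

(** Finite index is not a first-order condition, whereas index at most [D] is one. An almost
    containment that has to be definable therefore needs a bound on the index that is uniform in the
    parameters. The dimension alone does not give it, since a finite index, however large, leaves
    the dimension unchanged; in an ultrapower, indices that grow with the coordinate become infinite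
    and are seen. Finite indices cannot be absorbed by passing to a connected component: a
    descending chain of definable subgroups of finite index need not stop, so there may be no
    smallest one. This is why containments and centralizers appear in their almost form throughout.
    The quotient by [A] is never formed: relations modulo [A] are used inside g, so that one coding
    of g by tuples serves for every step. Nilpotency of an ideal is read off its action on the whole
    of g, which behaves well under sums, intersections and passage to finite index. *)

Section AlmostContainment.
Variable G : zmodType.
Implicit Types (H K N P : set G) (s : seq G).

(** This is [subgroup] for a bare abelian group, convertible with it on a Lie ring. The ultrapower
    of g is used as a group only. *)
Definition zsub N := N 0 /\ (forall x y, N x -> N y -> N (x - y)).

Lemma zsubN N x : zsub N -> N x -> N (- x).
Proof. by move=> [N0 NB] Nx; rewrite -[- x]add0r; exact: NB. Qed.

Lemma zsubD N x y : zsub N -> N x -> N y -> N (x + y).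
Proof. by move=> zN Nx Ny; rewrite -[y]opprK; apply: zN.2 => //; exact: zsubN. Qed.

Definition covers s H N := forall h, H h -> exists2 r, r \in s & N (h - r).

(* For subgroups: [H `&` N] has finite index in [H]. *)
Definition ale H N := exists s, covers s H N.

Definition alen H N d := exists2 s, size s = d & covers s H N.

(** A lower bound for the index. The family is indexed by nat, with values of interest below [d]
    only, so that families for growing [d] can be assembled coordinatewise in an ultrapower. *)
Definition separated H N d := exists y : nat -> G,
  (forall i, (i < d)%N -> H (y i)) /\
  (forall i j, (i < j)%N -> (j < d)%N -> ~ N (y j - y i)).

(** One representative is picked per colour; a colour that does not occur in [H] gets 0. *)
Lemma ale_colours (T : eqType) (c : G -> T -> Prop) (t : seq T) H N :
    (forall h, H h -> exists2 i, i \in t & c h i) ->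
    (forall h h' i, H h -> H h' -> c h i -> c h' i -> N (h - h')) ->
  ale H N.
Proof.
move=> tc cN.
have /choice[rep repP] : forall i, exists r,
    forall h, H h -> c h i -> H r /\ c r i.
  move=> i; have [[h [Hh ch]]|no] := pselect (exists h, H h /\ c h i).
    by exists h.
  by exists 0 => h Hh ch; case: no; exists h.
exists (map rep t) => h Hh; have [i it ci] := tc h Hh.
exists (rep i); first exact: map_f.
by have [? ?] := repP i h Hh ci; exact: (cN _ _ i).
Qed.

Lemma covers_sub s H H' N N' : H' `<=` H -> N `<=` N' ->
  covers s H N -> covers s H' N'.
Proof. by move=> sH sN c h /sH/c[r rs /sN Nr]; exists r. Qed.

Lemma ale_sub H H' N N' : H' `<=` H -> N `<=` N' -> ale H N -> ale H' N'.
Proof. by move=> sH sN [s c]; exists s; exact: (covers_sub sH sN c). Qed.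

Lemma ale_refl H N : N 0 -> H `<=` N -> ale H N.
Proof. by move=> N0 HN; exists [:: 0] => h /HN ?; exists 0; rewrite ?inE ?subr0. Qed.

Lemma covers_trans s t H N P : covers s H N -> covers t N P ->
  covers [seq r + q | r <- s, q <- t] H P.
Proof.
move=> sc tc h /sc[r rs /tc[q qt]]; rewrite -addrA -opprD => ?.
by exists (r + q) => //; exact: allpairs_f.
Qed.

Lemma ale_trans H N P : ale H N -> ale N P -> ale H P.
Proof. by move=> [s sc] [t tc]; eexists; exact: covers_trans sc tc. Qed.

Lemma alen_leq H N d e : (d <= e)%N -> alen H N d -> alen H N e.
Proof.
move=> de [s sd sc]; exists (s ++ nseq (e - d) 0).
  by rewrite size_cat size_nseq sd subnKC.
by move=> h /sc[r rs ?]; exists r; rewrite ?mem_cat ?rs.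
Qed.

Lemma alen_ale H N d : alen H N d -> ale H N.
Proof. by case=> s _ ?; exists s. Qed.

Lemma ale_hom (f : G -> G) H H' N : zsub N ->
    (forall x y, f (x - y) = f x - f y) -> (forall h, H h -> H' (f h)) ->
  ale H' N -> ale H (fun x => N (f x)).
Proof.
move=> zN fB fH [s sc].
apply: (@ale_colours G (fun h r => N (f h - r)) s).
  by move=> h /fH/sc.
move=> h h' r _ _ Nh Nh'.
have -> : f (h - h') = (f h - r) - (f h' - r) by rewrite fB opprB addrA subrK.
exact: zN.2.
Qed.

Lemma ale_cap_seq (T : eqType) (l : seq T) (P : T -> set G) H :
    (forall x, x \in l -> zsub (P x) /\ ale H (P x)) ->
  ale H [set h | forall x, x \in l -> P x h].
Proof.
elim: l => [_|a l IH Pl]; first by apply: ale_refl.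
have Pl' x : x \in l -> zsub (P x) /\ ale H (P x).
  by move=> xl; apply: Pl; rewrite inE xl orbT.
have [s sc] := IH Pl'.
have [za [t tc]] := Pl a (mem_head a l).
apply: (@ale_colours (G * G)%type (fun h p => P a (h - p.2) /\
  forall x, x \in l -> P x (h - p.1)) [seq (r, q) | r <- s, q <- t]).
  move=> h Hh; have [r rs Pr] := sc h Hh; have [q qt Pq] := tc h Hh.
  by exists (r, q); rewrite ?allpairs_f.
have cl (N : set G) h h' r : zsub N -> N (h - r) -> N (h' - r) -> N (h - h').
  move=> zN Nh Nh'.
  have -> : h - h' = (h - r) - (h' - r) by rewrite opprB addrA subrK.
  exact: zN.2.
move=> h h' [r q] _ _ /= [Pa Pr] [Pa' Pr'] x; rewrite inE => /predU1P[->|xl].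
  exact: cl Pa Pa'.
by apply: (cl _ _ _ r); [case: (Pl' x xl)|exact: Pr|exact: Pr'].
Qed.

Lemma ale_capI H N P : zsub N -> zsub P -> ale H N -> ale H P -> ale H (N `&` P).
Proof.
move=> zN zP HN HP.
have := @ale_cap_seq bool [:: true; false] (fun b => if b then N else P) H.
move=> /(_ (fun b _ => if b as b' return zsub (if b' then N else P) /\
  ale H (if b' then N else P) then conj zN HN else conj zP HP)).
apply: ale_sub => // h c; split; first exact: (c true).
exact: (c false).
Qed.

Lemma separated_sub d H H' N N' : H `<=` H' -> N' `<=` N ->
  separated H N d -> separated H' N' d.
Proof.
move=> sH sN [y [yH yN]]; exists y; split; first by move=> i /yH/sH.
by move=> i j ij jd /sN; exact: yN.
Qed.

(** Greedy choice: fewer than [d] cosets never cover [H], so any shorter list can be extended by an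
    element outside its cosets. *)
Lemma Nseparated_alen H N d : ~ separated H N d -> alen H N d.
Proof.
move=> nsep; apply: contrapT => nal; apply: nsep.
have /choice[F FP] : forall s, exists h, (size s < d)%N ->
    H h /\ forall r, r \in s -> ~ N (h - r).
  move=> s; case: (ltnP (size s) d) => sd; last by exists 0.
  apply: contrapT => no; apply: nal.
  apply: (@alen_leq _ _ (size s)); first exact: ltnW.
  exists s => // h Hh; apply: contrapT => no2; apply: no; exists h => _.
  by split=> // r rs Nr; apply: no2; exists r.
pose l n := iter n (fun s => F s :: s) [::].
have szl n : size (l n) = n by elim: n => //= n ->.
have Fl i j : (i < j)%N -> F (l i) \in l j.
  elim: j => // j IH; rewrite ltnS leq_eqVlt => /predU1P[->|/IH ij].
    exact: mem_head.
  by rewrite /= inE ij orbT.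
exists (fun i => F (l i)); split=> [i id|i j ij jd].
  by apply: (FP (l i) _).1; rewrite szl.
by apply: (FP (l j) _).2; [rewrite szl|exact: Fl].
Qed.

Lemma Nale_separated H N d : ~ ale H N -> separated H N d.
Proof. by move=> na; apply: contrapT => /Nseparated_alen/alen_ale. Qed.

Lemma separated_le H N d s : zsub N -> covers s H N -> separated H N d ->
  (d <= size s)%N.
Proof.
move=> zN sc [y [yH yN]].
have /choice[c cP] : forall i : 'I_d, exists r, r \in s /\ N (y i - r).
  by move=> i; have [r] := sc _ (yH i (ltn_ord i)); exists r.
have cinj : injective c.
  have key (i j : 'I_d) : (i < j)%N -> c i <> c j.
    move=> ij cij; apply: (yN i j ij (ltn_ord j)).
    have -> : y j - y i = (y j - c j) - (y i - c j) by rewrite opprB addrA subrK.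
    by apply: zN.2; [exact: (cP j).2|rewrite -cij; exact: (cP i).2].
  move=> i j cij; apply: val_inj; case: (ltngtP i j) => // lij.
    by case: (key i j lij).
  by case: (key j i lij).
have := @uniq_leq_size _ (map c (enum 'I_d)) s.
rewrite map_inj_uniq // enum_uniq size_map size_enum_ord; apply=> //.
by move=> x /mapP[i _ ->]; exact: (cP i).1.
Qed.

Lemma infinite_separated_Nale H N (y : nat -> G) : zsub N ->
    (forall i, H (y i)) -> (forall i j, (i < j)%N -> ~ N (y j - y i)) ->
  ~ ale H N.
Proof.
move=> zN yH yN [s sc]; have := @separated_le H N (size s).+1 s zN sc.
rewrite ltnn; move=> h; suff: false by []. apply: h.
by exists y; split=> // i j ij _; exact: yN.
Qed.

End AlmostContainment.

(** * Nilpotent ideals through iterated annihilators *)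

Section Lie.
Variable g : lieRing.
Implicit Types (A H I J K N X : set g) (x y z v : g).

Lemma br_is_additive_r x : zmod_morphism (br x).
Proof.
move=> y z; apply: (addIr (br x z)).
by rewrite -brDr !subrK.
Qed.
HB.instance Definition _ x := GRing.isZmodMorphism.Build g g (br x) (br_is_additive_r x).

Lemma brBr x y z : br x (y - z) = br x y - br x z.
Proof. exact: raddfB. Qed.

Lemma brNr x y : br x (- y) = - br x y.
Proof. exact: raddfN. Qed.

Lemma br0r x : br x 0 = 0.
Proof. exact: raddf0. Qed.

Lemma brBl x y z : br (x - y) z = br x z - br y z.
Proof. by rewrite br_antisym brBr opprB addrC -br_antisym (br_antisym z y). Qed.

Lemma br_br x y v : br x (br y v) = br (br x y) v + br y (br x v).
Proof.
have := br_jacobi x y v; rewrite (br_antisym v x) brNr (br_antisym v).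
by move=> /eqP; rewrite subr_eq0 subr_eq => /eqP.
Qed.

Lemma idealr I x y : ideal I -> I y -> I (br x y).
Proof. by move=> iI; exact: iI.2. Qed.

Lemma ideall I x y : ideal I -> I x -> I (br x y).
Proof. by move=> iI Ix; rewrite br_antisym; apply: (zsubN iI.1); exact: iI.2. Qed.

(** The elements v with [x1, [x2, ..., [xk, v]]] in [A] for all xi in [I]. Unlike [lcs] this
    involves no generated subgroup, and it is monotone: decreasing in [I], increasing in [A]. *)
Fixpoint ann I k A : set g :=
  if k is k'.+1 then [set v | forall x, I x -> ann I k' A (br x v)] else A.

Lemma ann_zsub I k A : zsub A -> zsub (ann I k A).
Proof.
move=> zA; elim: k => //= k [IH0 IHB]; split=> [x Ix|x y Ax Ay z Iz].
  by rewrite br0r.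
by rewrite brBr; apply: IHB; [exact: Ax|exact: Ay].
Qed.

Lemma ann_ideal I k A : ideal I -> ideal A -> ideal (ann I k A).
Proof.
move=> iI iA; split; first by apply: ann_zsub; case: iA.
elim: k => [|k IH] /= x y; first exact: iA.2.
move=> Ay z Iz; rewrite br_br; apply: zsubD; first by apply: ann_zsub; case: iA.
  by apply: Ay; exact: ideall.
by apply: IH; exact: Ay.
Qed.

Lemma ann_sub I J k A B : J `<=` I -> A `<=` B -> ann I k A `<=` ann J k B.
Proof. by move=> JI AB; elim: k => //= k IH v Av x /JI Jx; apply: IH; exact: Av. Qed.

Lemma ann_add I k l A : ann I k (ann I l A) = ann I (k + l) A.
Proof. by elim: k => //= k ->. Qed.

Lemma ideal0 : ideal [set 0 : g].
Proof.
split; first by split=> [|x y /= -> ->]; rewrite ?subr0.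
by move=> x y /= ->; rewrite br0r.
Qed.

(** The brackets act on all of g and not only on [I]. For an ideal this is still nilpotency: [I, g]
    lies in [I], so one additional bracket is enough. *)
Definition adnil I := exists k, ann I k [set 0] = setT.

Lemma nilpotent_adnil I : ideal I -> nilpotent I <-> adnil I.
Proof.
move=> iI; have z0 : zsub [set 0 : g] by case: ideal0.
split=> [[k lk]|[k ak]].
  have low j : (j <= k)%N -> lcs I (k - j) `<=` ann I j [set 0].
    elim: j => [_|j IH jk] /=; first by rewrite subn0 lk.
    move=> v Lv x Ix; apply: IH; first exact: ltnW.
    have -> : (k - j = (k - j.+1).+1)%N by lia.
    rewrite br_antisym -(brNr v) /=; apply: sub_gen_smallest.
    by exists v => //; exists (- x) => //; exact: (zsubN iI.1).
  exists k.+1; apply/seteqP; split=> // v _ x Ix.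
  by apply: (low k (leqnn k)); rewrite subnn; exact: ideall.
exists k; apply/seteqP; split; last first.
  move=> _ ->; case: k {ak} => [|k] /=; first by case: (iI.1).
  by move=> B [[B0 _] _].
have low j : (j <= k)%N -> lcs I j `<=` ann I (k - j) [set 0].
  elim: j => [_|j IH jk] /=; first by rewrite subn0 ak.
  apply: smallest_sub; first exact: ann_zsub.
  move=> _ [x Lx [y Iy <-]]; rewrite br_antisym.
  apply: zsubN; first exact: ann_zsub.
  have := IH (ltnW jk) x Lx; have -> : (k - j = (k - j.+1).+1)%N by lia.
  by apply.
by have := low k (leqnn k); rewrite subnn.
Qed.

Definition sumset I J : set g := [set x | exists2 y, I y & exists2 z, J z & x = y + z].

Lemma sumset_ideal I J : ideal I -> ideal J -> ideal (sumset I J).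
Proof.
move=> [[I0 IB] Ir] [[J0 JB] Jr]; split; [split|].
- by exists 0 => //; exists 0; rewrite ?addr0.
- move=> _ _ [x Ix [y Jy ->]] [x' Ix' [y' Jy' ->]].
  exists (x - x'); first exact: IB.
  by exists (y - y'); [exact: JB|rewrite opprD addrACA].
- move=> x _ [y Iy [z Jz ->]]; exists (br x y); first exact: Ir.
  by exists (br x z); [exact: Jr|rewrite brDr].
Qed.

(** Fitting's argument by counting: a bracket with x + y splits in two, where the part with x uses
    up one of the [k] brackets with [I] and the part with y one of the [l] brackets with [J]. The
    other count is not spoiled, because annihilators are ideals. *)
Lemma sumset_adnil I J : ideal I -> ideal J -> adnil I -> adnil J ->
  adnil (sumset I J).
Proof.
move=> iI iJ [k Ik] [l Jl]; exists (k + l)%N.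
have zS m : zsub (ann (sumset I J) m [set 0]) by apply: ann_zsub; case: ideal0.
suff key t a b : (a + b = t)%N ->
    ann I a [set 0] `&` ann J b [set 0] `<=` ann (sumset I J) t [set 0].
  apply/seteqP; split=> // v _; apply: (key _ k l erefl).
  by rewrite Ik Jl.
elim: t a b => [|t IH] a b abt v [Av Bv].
  by move: abt Av => /eqP; rewrite addn_eq0 => /andP[/eqP-> _].
have [a0|a_gt0] := posnP a.
  by move: Av; rewrite a0 => /= ->; exact: (zS _.+1).1.
have [b0|b_gt0] := posnP b.
  by move: Bv; rewrite b0 => /= ->; exact: (zS _.+1).1.
move=> _ [x Ix [y Jy ->]]; rewrite brDl; apply: zsubD => //.
  apply: (IH a.-1 b); first by lia.
  split; last exact: (ann_ideal _ iJ ideal0).2.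
  by move: Av; rewrite -{1}(prednK a_gt0) /=; apply.
apply: (IH a b.-1); first by lia.
split; first exact: (ann_ideal _ iI ideal0).2.
by move: Bv; rewrite -{1}(prednK b_gt0) /=; apply.
Qed.

(** The sum of two nilpotent ideals is nilpotent, so the union of all of them is already a
    subgroup. *)
Lemma fittingE : fitting g = [set x | exists I, [/\ ideal I, adnil I & I x]].
Proof.
apply/seteqP; split.
  apply: smallest_sub; first split.
  - exists [set 0]; split=> //; first exact: ideal0.
    by exists 1%N; apply/seteqP; split=> // v _ /= x ->; rewrite br_antisym br0r oppr0.
  - move=> x y [I [iI nI Ix]] [J [iJ nJ Jy]]; exists (sumset I J); split.
    + exact: sumset_ideal.
    + exact: sumset_adnil.
    + by exists x => //; exists (- y) => //; exact: (zsubN iJ.1).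
  - by move=> x [I [iI /(nilpotent_adnil iI) nI] Ix]; exists I.
move=> x [I [iI nI Ix]]; apply: sub_gen_smallest; exists I => //.
by split=> //; exact/nilpotent_adnil.
Qed.

Lemma fitting_seq (l : seq g) : (forall x, x \in l -> fitting g x) ->
  exists I, [/\ ideal I, adnil I & forall x, x \in l -> I x].
Proof.
elim: l => [_|a l IH al].
  exists [set 0]; split=> //; first exact: ideal0.
  by exists 1%N; apply/seteqP; split=> // v _ /= x ->; rewrite br_antisym br0r oppr0.
have [x xl|J [iJ nJ Jl]] := IH; first by apply: al; rewrite inE xl orbT.
have := al a (mem_head a l); rewrite fittingE => -[I [iI nI Ia]].
exists (sumset I J); split; [exact: sumset_ideal|exact: sumset_adnil|].
move=> x; rewrite inE => /predU1P[->|/Jl Jx].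
  by exists a => //; exists 0; [exact: iJ.1.1|rewrite addr0].
by exists 0; [exact: iI.1.1|exists x; rewrite ?add0r].
Qed.

Lemma fitting_ideal : ideal (fitting g).
Proof.
split; first split.
- by move=> B [[]].
- move=> x y Fx Fy B [sB hB]; apply: sB.2; first exact: Fx.
  exact: Fy.
- move=> x y; rewrite fittingE => -[I [iI nI Iy]]; exists I; split=> //.
  exact: idealr.
Qed.

End Lie.

(** * Definable relations *)

Section Renaming.
Variable L : language.

Fixpoint trename n m (s : 'I_n -> 'I_m) (t : term L n) : term L m :=
  match t with
  | TVar i => TVar L (s i)
  | TApp k f u => TApp f (fun i => trename s (u i))
  end.

Definition lift_ren n m (s : 'I_n -> 'I_m) (i : 'I_n.+1) : 'I_m.+1 :=
  if unlift ord0 i is Some j then lift ord0 (s j) else ord0.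

Fixpoint frename n (phi : formula L n) : forall m, ('I_n -> 'I_m) -> formula L m :=
  match phi in formula _ n return forall m, ('I_n -> 'I_m) -> formula L m with
  | FBot _ => fun m s => FBot L m
  | FEq _ t u => fun m s => FEq (trename s t) (trename s u)
  | FRel _ k r u => fun m s => FRel r (fun i => trename s (u i))
  | FImp _ p q => fun m s => FImp (frename p s) (frename q s)
  | FAll _ p => fun m s => FAll (frename p (lift_ren s))
  end.

Variable M : structure L.

Lemma eval_rename n m (s : 'I_n -> 'I_m) (t : term L n) (v : m.-tuple M) :
  eval v (trename s t) = eval [tuple tnth v (s i) | i < n] t.
Proof.
elim: t => [i|k f u IH] /=; first by rewrite tnth_mktuple.
by congr fint; apply: eq_from_tnth => i; rewrite !tnth_mktuple IH.
Qed.

Lemma cons_tuple_ren n m (s : 'I_n -> 'I_m) (v : m.-tuple M) (a : M) :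
  [tuple tnth (cons_tuple a v) (lift_ren s i) | i < n.+1] =
  cons_tuple a [tuple tnth v (s i) | i < n].
Proof.
apply: eq_from_tnth => i; rewrite tnth_mktuple /lift_ren.
by case: unliftP => [j|] ->; rewrite ?tnthS ?tnth_mktuple ?tnth0.
Qed.

Lemma sat_rename n (phi : formula L n) m (s : 'I_n -> 'I_m) (v : m.-tuple M) :
  sat (frename phi s) v <-> sat phi [tuple tnth v (s i) | i < n].
Proof.
elim: phi m s v => [//|{}n t u|{}n k r u|{}n p IHp q IHq|{}n p IHp] m s v /=.
- by rewrite !eval_rename.
- suff -> : [tuple eval v (trename s (u i)) | i < k] =
            [tuple eval [tuple tnth v (s i) | i < n] (u i) | i < k] by [].
  by apply: eq_from_tnth => i; rewrite !tnth_mktuple eval_rename.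
- by split=> pq /IHp/pq/IHq.
- by split=> H a; have := H a; rewrite -?cons_tuple_ren IHp.
Qed.

End Renaming.

Section Definability.
Variables (L : language) (M : structure L).

Definition assign I N (s : 'I_N -> I + M) (v : I -> M) : N.-tuple M :=
  [tuple match s i with inl j => v j | inr a => a end | i < N].

(* Definability with parameters for relations whose places are labelled by an
   arbitrary type. *)
Definition defin I (P : (I -> M) -> Prop) :=
  exists N (phi : formula L N) (s : 'I_N -> I + M),
    forall v, P v <-> sat phi (assign s v).

Lemma defin_ext I (P Q : (I -> M) -> Prop) :
  (forall v, P v <-> Q v) -> defin P -> defin Q.
Proof.
move=> PQ [N [phi [s sP]]]; exists N, phi, s => v.
by split=> [/PQ/sP|/sP/PQ].
Qed.

Lemma defin_subst I J (f : I -> J + M) (P : (I -> M) -> Prop) : defin P ->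
  defin (fun v => P (fun i => match f i with inl j => v j | inr a => a end)).
Proof.
move=> [N [phi [s sP]]]; exists N, phi.
exists (fun i => match s i with inl j => f j | inr a => inr a end) => v.
rewrite sP; suff -> : assign s (fun i => match f i with inl j => v j | inr a => a end)
  = assign (fun i => match s i with inl j => f j | inr a => inr a end) v by [].
by apply: eq_from_tnth => i; rewrite !tnth_mktuple; case: (s i).
Qed.

Lemma defin_reindex I J (f : I -> J) (P : (I -> M) -> Prop) : defin P ->
  defin (fun v => P (fun i => v (f i))).
Proof. exact: (@defin_subst I J (fun i => inl (f i))). Qed.

Lemma defin_false I : defin (fun _ : I -> M => False).
Proof.
by have [m0] := carrier_inhabited M; exists 0%N, (FBot L 0), (fun=> inr m0).
Qed.

Lemma defin_imp I (P Q : (I -> M) -> Prop) : defin P -> defin Q ->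
  defin (fun v => P v -> Q v).
Proof.
move=> [N1 [phi1 [s1 sP]]] [N2 [phi2 [s2 sQ]]].
exists (N1 + N2)%N, (FImp (frename phi1 (@lshift N1 N2)) (frename phi2 (@rshift N1 N2))).
exists (fun i => match fintype.split i with inl j => s1 j | inr j => s2 j end) => v.
rewrite sP sQ /= !sat_rename.
set t1 := [tuple _ | _ < _]; set t2 := [tuple _ | _ < N2].
suff [-> ->] : assign s1 v = t1 /\ assign s2 v = t2 by [].
split; apply: eq_from_tnth => i; rewrite !tnth_mktuple.
  case: split_ordP => j /(congr1 val) /= E; last by have := ltn_ord i; lia.
  by have -> : j = i by exact: val_inj.
case: split_ordP => j /(congr1 val) /= E; first by have := ltn_ord j; lia.
by have -> : j = i by apply: val_inj => /=; lia.
Qed.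

Lemma defin_not I (P : (I -> M) -> Prop) : defin P -> defin (fun v => ~ P v).
Proof. by move=> dP; apply: defin_imp => //; exact: defin_false. Qed.

Lemma defin_and I (P Q : (I -> M) -> Prop) : defin P -> defin Q ->
  defin (fun v => P v /\ Q v).
Proof.
move=> dP dQ; apply: (@defin_ext _ (fun v => ~ (P v -> ~ Q v))).
  by move=> v; rewrite not_implyE not_notE.
by apply: defin_not; apply: defin_imp => //; exact: defin_not.
Qed.

Lemma defin_or I (P Q : (I -> M) -> Prop) : defin P -> defin Q ->
  defin (fun v => P v \/ Q v).
Proof.
move=> dP dQ; apply: (@defin_ext _ (fun v => ~ P v -> Q v)).
  by move=> v; rewrite implyE not_notE.
by apply: defin_imp => //; exact: defin_not.
Qed.

Lemma defin_eq I (i j : I) : defin (fun v : I -> M => v i = v j).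
Proof.
exists 2%N, (FEq (TVar L ord0) (TVar L ord_max)).
exists (fun k => inl (if k == ord0 then i else j)) => v /=.
by rewrite !tnth_mktuple.
Qed.

Definition ext I T (v : I -> T) (a : T) (o : option I) : T :=
  if o is Some i then v i else a.

Lemma defin_all I (P : (option I -> M) -> Prop) : defin P ->
  defin (fun v => forall a, P (ext v a)).
Proof.
move=> [N [phi [s sP]]]; have [m0] := carrier_inhabited M.
(* Places labelled [None] are redirected to the bound variable; their former slots are no longer
   read and are filled with [m0]. *)
pose r (i : 'I_N) : 'I_N.+1 := if s i is inl None then ord0 else lift ord0 i.
exists N, (FAll (frename phi r)).
exists (fun i => match s i with
  inl (Some j) => inl j | inl None => inr m0 | inr a => inr a end) => v /=.
suff E a : P (ext v a) <-> sat (frename phi r) (cons_tuple a (assign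
    (fun i => match s i with
       inl (Some j) => inl j | inl None => inr m0 | inr a => inr a end) v)).
  by split=> H a; have := H a; rewrite E.
rewrite sP sat_rename; set t := [tuple _ | _ < _].
suff -> : assign s (ext v a) = t by [].
apply: eq_from_tnth => i; rewrite !tnth_mktuple /r.
by case E: (s i) => [[j|]|b]; rewrite ?tnthS ?tnth0 ?tnth_mktuple ?E.
Qed.

Lemma defin_all_tuple n I (P : (I + 'I_n -> M) -> Prop) : defin P ->
  defin (fun v => forall a : 'I_n -> M,
    P (fun k => match k with inl i => v i | inr j => a j end)).
Proof.
elim: n I P => [|n IH] I P dP.
  have [m0] := carrier_inhabited M.
  pose f (k : I + 'I_0) : I + M := if k is inl i then inl i else inr m0.
  apply: defin_ext (defin_subst f dP) => v.
  have E a : (fun i => match f i with inl j => v j | inr a0 => a0 end) =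
      (fun k => match k with inl i => v i | inr j => a j end).
    by apply: funext => -[i|[]].
  by split=> [H a|H]; [rewrite -E|rewrite (E (fun=> m0))].
pose h (k : I + 'I_n.+1) : option I + 'I_n :=
  match k with
  | inl i => inl (Some i)
  | inr j => if unlift ord0 j is Some j' then inr j' else inl None
  end.
apply: defin_ext (defin_all (IH _ _ (defin_reindex h dP))) => v.
split=> [H a|H b a].
  have := H (a ord0) (fun j => a (lift ord0 j)).
  congr P; apply: funext => -[i|j] //=.
  by case: unliftP => [j'|] ->.
have := H (fun j => if unlift ord0 j is Some j' then a j' else b).
congr P; apply: funext => -[i|j] //=.
by case: unliftP.
Qed.

Lemma defin_eq_tuple n I (f h : 'I_n -> I) :
  defin (fun v : I -> M => forall k, v (f k) = v (h k)).
Proof.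
have key (l : seq 'I_n) : defin (fun v : I -> M => forall k, k \in l -> v (f k) = v (h k)).
  elim: l => [|a l IH].
    apply: defin_ext (defin_imp (@defin_false I) (@defin_false I)) => v.
    by split=> // _ k.
  apply: defin_ext (defin_and (defin_eq (f a) (h a)) IH) => v; split.
    by move=> [E H] k; rewrite inE => /predU1P[->|/H].
  by move=> H; split=> [|k kl]; apply: H; rewrite inE ?eqxx ?kl ?orbT.
apply: defin_ext (key (enum 'I_n)) => v.
by split=> H k; [apply: H; rewrite mem_enum|move=> _; exact: H].
Qed.

Lemma tuple_of_tnth n (T : Type) (t : n.-tuple T) : [tuple tnth t i | i < n] = t.
Proof. by apply: eq_from_tnth => i; rewrite tnth_mktuple. Qed.

(** In [definable] the parameters form a final block, in [defin] they may sit anywhere. A renaming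
    separates them from the variables; slots of the block that correspond to variables are filled
    with [m0]. *)
Lemma definableP n (D : set (n.-tuple M)) :
  definable D <-> defin (fun v : 'I_n -> M => D [tuple v i | i < n]).
Proof.
split=> [[k [phi [a ->]]]|[N [phi [s sD]]]].
  exists (n + k)%N, phi.
  exists (fun i => match fintype.split i with inl j => inl j
    | inr j => inr (tnth a j) end) => v.
  rewrite /defset /=; set t := assign _ _.
  suff -> : cat_tuple [tuple v i | i < n] a = t by [].
  apply: eq_from_tnth => i; rewrite tnth_mktuple.
  by case: split_ordP => j ->; rewrite ?tnth_lshift ?tnth_rshift ?tnth_mktuple.
have [m0] := carrier_inhabited M.
exists N, (frename phi (fun i => if s i is inl j then lshift N j else rshift n i)).
exists [tuple (if s i is inr a then a else m0) | i < N].
apply/seteqP; suff E t : D t <-> defset (frename phi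
    (fun i => if s i is inl j then lshift N j else rshift n i))
    [tuple (if s i is inr a then a else m0) | i < N] t.
  by split=> t /E.
rewrite -{1}(tuple_of_tnth t) sD /defset /= sat_rename.
set u := [tuple _ | _ < _]; suff -> : assign s (tnth t) = u by [].
apply: eq_from_tnth => i; rewrite !tnth_mktuple.
by case E: (s i) => [j|b]; rewrite ?tnth_lshift ?tnth_rshift ?tnth_mktuple ?E.
Qed.

End Definability.

(** * Definable relations on a set coded by tuples *)

Section CodedDefinability.
Variables (L : language) (M : structure L) (n : nat) (G : Type).
Variable iota : G -> n.-tuple M.
Hypotheses (iotaI : injective iota) (drange : definable (range iota)).

Definition coded V (v : V -> G) (q : V * 'I_n) : M := tnth (iota (v q.1)) q.2.

(** Nothing is asked of [P] off the tuples of codes; quantifiers over [G] are therefore relativised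
    to [range iota]. *)
Definition gdef V (R : (V -> G) -> Prop) :=
  exists2 P, defin P & forall v, R v <-> P (coded v).

Definition gfun V (f : (V -> G) -> G) :=
  gdef (fun w : option V -> G => w None = f (fun i => w (Some i))).

Lemma gdef_ext V (R S : (V -> G) -> Prop) :
  (forall v, R v <-> S v) -> gdef R -> gdef S.
Proof. by move=> RS [P dP RP]; exists P => // v; split=> [/RS/RP|/RP/RS]. Qed.

Lemma gdef_reindex V W (s : V -> W) (R : (V -> G) -> Prop) : gdef R ->
  gdef (fun v => R (fun i => v (s i))).
Proof.
move=> [P dP RP].
exists (fun u => P (fun q => u (s q.1, q.2))); first exact: (defin_reindex _ dP).
by move=> v; rewrite RP.
Qed.

Lemma gdef_imp V (R S : (V -> G) -> Prop) : gdef R -> gdef S ->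
  gdef (fun v => R v -> S v).
Proof.
move=> [P dP RP] [Q dQ SQ]; exists (fun u => P u -> Q u); first exact: defin_imp.
by move=> v; rewrite RP SQ.
Qed.

Lemma gdef_not V (R : (V -> G) -> Prop) : gdef R -> gdef (fun v => ~ R v).
Proof.
by move=> [P dP RP]; exists (fun u => ~ P u); [exact: defin_not|move=> v; rewrite RP].
Qed.

Lemma gdef_and V (R S : (V -> G) -> Prop) : gdef R -> gdef S ->
  gdef (fun v => R v /\ S v).
Proof.
move=> [P dP RP] [Q dQ SQ]; exists (fun u => P u /\ Q u); first exact: defin_and.
by move=> v; rewrite RP SQ.
Qed.

Lemma gdef_or V (R S : (V -> G) -> Prop) : gdef R -> gdef S ->
  gdef (fun v => R v \/ S v).
Proof.
move=> [P dP RP] [Q dQ SQ]; exists (fun u => P u \/ Q u); first exact: defin_or.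
by move=> v; rewrite RP SQ.
Qed.

Lemma gdef_false V : gdef (fun _ : V -> G => False).
Proof. by exists (fun=> False) => //; exact: defin_false. Qed.

Lemma range_tuple (a : 'I_n -> M) : range iota [tuple a i | i < n] <->
  exists x, a = tnth (iota x).
Proof.
split=> [[x _ E]|[x ->]]; last by exists x; rewrite ?tuple_of_tnth.
by exists x; apply: funext => i; rewrite E tnth_mktuple.
Qed.

Lemma gdef_all V (R : (option V -> G) -> Prop) : gdef R ->
  gdef (fun v => forall x, R (ext v x)).
Proof.
move=> [P dP RP].
pose s (q : option V * 'I_n) : (V * 'I_n) + 'I_n :=
  if q.1 is Some i then inl (i, q.2) else inr q.2.
pose r : 'I_n -> (V * 'I_n) + 'I_n := inr.
have d1 := defin_reindex s dP.
have /definableP/(defin_reindex r) d2 := drange.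
eexists; first exact: (defin_all_tuple (defin_imp d2 d1)).
move=> v; split=> [H a|H x].
  change (range iota [tuple a i | i < n] -> P (fun i => match s i with
    | inl j => coded v j | inr j => a j end)).
  move=> /range_tuple[x ->]; have /RP := H x.
  by congr P; apply: funext => -[[i|] k].
apply/RP; have := H (tnth (iota x)).
have /range_tuple rx : exists y, tnth (iota x) = tnth (iota y) by exists x.
by move=> /(_ rx); congr P; apply: funext => -[[i|] k].
Qed.

Lemma gdef_ex V (R : (option V -> G) -> Prop) : gdef R ->
  gdef (fun v => exists x, R (ext v x)).
Proof.
move=> dR; apply: gdef_ext (gdef_not (gdef_all (gdef_not dR))) => v.
split=> [H|[x Rx] H]; last exact: H Rx.
by apply: contrapT => no; apply: H => x Rx; apply: no; exists x.
Qed.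

Lemma gdef_param V (R : (option V -> G) -> Prop) (c : G) : gdef R ->
  gdef (fun v => R (ext v c)).
Proof.
move=> [P dP RP].
pose s (q : option V * 'I_n) : (V * 'I_n) + M :=
  if q.1 is Some i then inl (i, q.2) else inr (tnth (iota c) q.2).
eexists; first exact: (defin_subst s dP).
move=> v; rewrite RP; suff -> : coded (ext v c) = (fun i => match s i with
  | inl j => coded v j | inr a => a end) by [].
by apply: funext => -[[i|] k].
Qed.

Lemma gdef_eq V (i j : V) : gdef (fun v : V -> G => v i = v j).
Proof.
exists (fun u => forall k, u (i, k) = u (j, k)).
  exact: (@defin_eq_tuple _ M n (V * 'I_n)%type (pair i) (pair j)).
move=> v; split=> [E k|E]; first by rewrite /coded /= E.
by apply: iotaI; apply: eq_from_tnth => k; exact: E.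
Qed.

Lemma gfun_reindex V W (s : V -> W) f : gfun f ->
  gfun (fun w : W -> G => f (fun i => w (s i))).
Proof. exact: (@gdef_reindex (option V) (option W) (omap s)). Qed.

Lemma gfun_var V (i : V) : gfun (fun v : V -> G => v i).
Proof. exact: gdef_eq. Qed.

Lemma gfun_cst V (c : G) : gfun (fun _ : V -> G => c).
Proof.
exact: (gdef_param c (@gdef_eq (option (option V)) (Some None) None)).
Qed.

Lemma gdef_app V (R : (option V -> G) -> Prop) f : gdef R -> gfun f ->
  gdef (fun v => R (ext v (f v))).
Proof.
move=> dR df; apply: gdef_ext (gdef_all (gdef_imp df dR)) => v.
by split=> [H|H x /= ->//]; exact: H.
Qed.

Lemma gfun_op2 V (op : G -> G -> G) f h :
    gfun (fun v : bool -> G => op (v true) (v false)) -> gfun f -> gfun h ->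
  gfun (fun v : V -> G => op (f v) (h v)).
Proof.
move=> dop df dh; rewrite /gfun.
pose s (o : option bool) : option (option (option V)) :=
  match o with
  | None => Some (Some None) | Some true => Some None | Some false => None end.
have d1 : gdef (fun w : option (option (option V)) -> G =>
  w (Some (Some None)) = op (w (Some None)) (w None)) := gdef_reindex s dop.
have d2 := gdef_app d1 (gfun_reindex (Some \o Some) dh).
exact: (gdef_app d2 (gfun_reindex Some df)).
Qed.

Definition defg (A : set G) := definable (iota @` A).

Lemma defgP (A : set G) : defg A <-> gdef (fun v : unit -> G => A (v tt)).
Proof.
split=> [/definableP dA|[P dP AP]].
  exists (fun u => (iota @` A) [tuple u (tt, i) | i < n]).
    exact: (@defin_reindex _ M _ _ (pair tt) _ dA).
  move=> v; rewrite /coded /= tuple_of_tnth.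
  by split=> [Av|[x Ax /iotaI<-//]]; exists (v tt).
apply/definableP; have /definableP dr := drange.
apply: defin_ext (defin_and dr (defin_reindex snd dP)) => a; split.
  rewrite range_tuple => -[[x ->] Px]; exists x; last by rewrite tuple_of_tnth.
  by have := (AP (fun=> x)).2; apply; move: Px; congr P; apply: funext => -[[] k].
move=> [x Ax E]; have Ea : a = tnth (iota x).
  by apply: funext => i; rewrite E tnth_mktuple.
split; first by rewrite range_tuple; exists x.
by have := (AP (fun=> x)).1 Ax; congr P; apply: funext => -[[] k]; rewrite Ea.
Qed.

Lemma gdef_mem V (A : set G) f : defg A -> gfun f -> gdef (fun v : V -> G => A (f v)).
Proof.
move=> /defgP dA df.
exact: (gdef_app (@gdef_reindex unit (option V) (fun=> None) _ dA) df).
Qed.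

Lemma gfun_op_graph (op : G -> G -> G) :
    definable [set cat_tuple (cat_tuple (iota x) (iota y)) (iota (op x y))
      | x in [set: G] & y in [set: G]] ->
  gfun (fun v : bool -> G => op (v true) (v false)).
Proof.
move=> /definableP d.
pose s (i : 'I_(n + n + n)) : option bool * 'I_n :=
  match fintype.split i with
  | inl j => match fintype.split j with
             | inl k => (Some true, k) | inr k => (Some false, k) end
  | inr k => (None, k)
  end.
eexists; first exact: (defin_reindex s d).
have cat_inj p q (a a' : p.-tuple M) (b b' : q.-tuple M) :
    cat_tuple a b = cat_tuple a' b' -> a = a' /\ b = b'.
  move=> E; split; apply: eq_from_tnth => i.
    by have := congr1 (fun t => tnth t (lshift q i)) E; rewrite /= !tnth_lshift.
  by have := congr1 (fun t => tnth t (rshift p i)) E; rewrite /= !tnth_rshift.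
move=> w; rewrite /=; set t := [tuple _ | i < _].
have -> : t = cat_tuple (cat_tuple (iota (w (Some true))) (iota (w (Some false))))
     (iota (w None)).
  apply: eq_from_tnth => i; rewrite tnth_mktuple /s /coded.
  case: split_ordP => [j|k] ->; rewrite ?tnth_lshift ?tnth_rshift //.
  by case: split_ordP => k ->; rewrite ?tnth_lshift ?tnth_rshift.
split=> [->|[x _ [y _]]]; first by exists (w (Some true)) => //; exists (w (Some false)).
by move=> /cat_inj[/cat_inj[/iotaI<- /iotaI<-] /iotaI<-].
Qed.

Definition code_rel (R : G -> G -> Prop) (t u : n.-tuple M) :=
  exists x y, [/\ t = iota x, u = iota y & R x y].

Lemma definable_code_rel (R : G -> G -> Prop) :
  gdef (fun v : bool -> G => R (v true) (v false)) ->
  definable (rel_set (code_rel R)).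
Proof.
move=> [P dP RP]; apply/definableP; have /definableP dr := drange.
have d1 := defin_reindex (@lshift n n) dr.
have d2 := defin_reindex (@rshift n n) dr.
have d3 := @defin_reindex _ _ _ _ (fun q : bool * 'I_n =>
  if q.1 then lshift n q.2 else rshift n q.2) _ dP.
apply: defin_ext (defin_and d1 (defin_and d2 d3)) => a; split.
  rewrite !range_tuple => -[[x Ex] [[y Ey] Pa]].
  exists (iota x), (iota y); split.
    exists x, y; split=> //; apply/(RP (fun b => if b then x else y)).
    move: Pa; congr P; apply: funext => -[[] k]; rewrite /coded /=.
      exact: (congr1 (@^~ k) Ex).
    exact: (congr1 (@^~ k) Ey).
  apply: eq_from_tnth => i; rewrite tnth_mktuple.
  by case: (split_ordP i) => j ->; rewrite ?tnth_lshift ?tnth_rshift -?Ex -?Ey.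
move=> [_ [_ [[x [y [-> -> Rxy]]] E]]].
have Ea i : a i = tnth (cat_tuple (iota x) (iota y)) i by rewrite -E tnth_mktuple.
rewrite !range_tuple; split; last split.
- by exists x; apply: funext => i; rewrite Ea tnth_lshift.
- by exists y; apply: funext => i; rewrite Ea tnth_rshift.
have /(RP (fun b => if b then x else y)) := Rxy.
congr P; apply: funext => -[[] k]; rewrite /coded /= Ea.
  by rewrite tnth_lshift.
by rewrite tnth_rshift.
Qed.

End CodedDefinability.

(** * Dimension of definable groups *)

Section Dimension.
Variables (L : language) (T : theory L).
Variable dim : forall (M : structure L) n, set (set (n.-tuple M)) -> dimension.
Hypothesis dimP : dimension_axioms T dim.
Variable M : structure L.
Hypothesis MT : models M T.
Variables (n : nat) (G : zmodType) (iota : G -> n.-tuple M).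
Hypotheses (iotaI : injective iota) (drange : definable (range iota)).
Hypothesis dadd : gfun iota (fun v : bool -> G => v true + v false).

Notation gdef := (gdef iota).
Notation gfun := (gfun iota).
Notation defg := (defg iota).
Implicit Types (A B H N : set G).

Lemma gdef_eqf V (f h : (V -> G) -> G) : gfun f -> gfun h ->
  gdef (fun v => f v = h v).
Proof.
move=> df dh.
have d := @gdef_eq _ M n G iota iotaI (option (option V)) (Some None) None.
exact: (gdef_app drange (gdef_app drange d (gfun_reindex Some dh)) df).
Qed.

Lemma gfun_add V (f h : (V -> G) -> G) : gfun f -> gfun h ->
  gfun (fun v => f v + h v).
Proof. exact: (gfun_op2 drange dadd). Qed.

Lemma gfun_opp V (f : (V -> G) -> G) : gfun f -> gfun (fun v => - f v).
Proof.
move=> df.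
have dS : gfun (fun w : option V -> G => f (fun i => w (Some i))).
  exact: gfun_reindex.
apply: gdef_ext (gdef_eqf (gfun_add dS (@gfun_var _ _ _ _ _ iotaI _ None))
  (@gfun_cst _ _ _ _ _ iotaI _ 0)) => w.
by rewrite addrC; split=> [/eqP|->]; rewrite ?addNr// addr_eq0 => /eqP.
Qed.

Lemma gfun_sub V (f h : (V -> G) -> G) : gfun f -> gfun h ->
  gfun (fun v => f v - h v).
Proof. by move=> df dh; apply: gfun_add => //; exact: gfun_opp. Qed.

Lemma defg_gdef A : gdef (fun v : unit -> G => A (v tt)) -> defg A.
Proof. by move=> d; exact/defgP. Qed.

Lemma gdef_memv V A (i : V) : defg A -> gdef (fun v => A (v i)).
Proof. by move=> dA; apply: (gdef_mem iotaI drange dA); exact: gfun_var. Qed.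

Lemma defg_cap A B : defg A -> defg B -> defg (A `&` B).
Proof.
by move=> dA dB; apply: defg_gdef; apply: gdef_and; exact: gdef_memv.
Qed.

Lemma defg_cup A B : defg A -> defg B -> defg (A `|` B).
Proof.
by move=> dA dB; apply: defg_gdef; apply: gdef_or; exact: gdef_memv.
Qed.

Lemma defg_set0 : defg set0.
Proof. by apply: defg_gdef; exact: gdef_false. Qed.

Lemma defg_set1 x : defg [set x].
Proof.
by apply: defg_gdef; apply: gdef_eqf; [exact: gfun_var|exact: gfun_cst].
Qed.

Lemma defg_preim A (f : (unit -> G) -> G) : defg A -> gfun f ->
  defg [set x | A (f (fun=> x))].
Proof.
move=> dA df; apply: defg_gdef.
apply: gdef_ext (gdef_mem iotaI drange dA df) => v /=.
by have -> : v = (fun=> v tt) by apply: funext => -[].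
Qed.

Definition classes A (R : G -> G -> Prop) := quot (iota @` A) (code_rel iota R).

Lemma classesE A R C :
  classes A R C <-> exists2 x, A x & C = iota @` [set y | A y /\ R x y].
Proof.
have E x : A x -> [set t | (iota @` A) t /\ code_rel iota R (iota x) t] =
    iota @` [set y | A y /\ R x y].
  move=> Ax; apply/seteqP; split=> t.
    by move=> [[y Ay <-] [x' [y' [/iotaI<- /iotaI<- Rxy]]]]; exists y.
  by move=> [y [Ay Rxy] <-]; split; [exists y|exists x, y].
split=> [[_ [x Ax <-] ->]|[x Ax ->]].
  by exists x; rewrite ?E.
by exists (iota x); [exists x|rewrite E].
Qed.

Lemma interpretable_classes A R : defg A ->
    gdef (fun v : bool -> G => R (v true) (v false)) ->
    (forall x, R x x) -> (forall x y, R x y -> R y x) ->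
    (forall x y z, R x y -> R y z -> R x z) ->
  interpretable (classes A R).
Proof.
move=> dA dR Rr Rs Rt; exists (iota @` A), (code_rel iota R); split=> //.
  exact: definable_code_rel.
split.
- by move=> _ [x Ax <-]; exists x, x.
- by move=> _ _ _ _ [x [y [-> -> /Rs Ryx]]]; exists y, x.
- move=> _ _ _ _ _ _ [x [y [-> -> Rxy]]] [y' [z [/iotaI<- -> Ryz]]].
  by exists x, z; split=> //; exact: Rt Ryz.
Qed.

(* The set [A], seen as the interpretable set of its singletons. *)
Definition sing A := classes A eq.

Lemma singE A C : sing A C <-> exists2 x, A x & C = [set iota x].
Proof.
have E x : A x -> iota @` [set y | A y /\ x = y] = [set iota x].
  move=> Ax; apply/seteqP; split=> t; first by move=> [_ [_ <-] <-].
  by move=> ->; exists x.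
rewrite /sing classesE.
by split=> -[x Ax ->]; exists x; rewrite ?E.
Qed.

Lemma interpretable_sing A : defg A -> interpretable (sing A).
Proof.
move=> dA; apply: interpretable_classes => //; last by move=> ? ? ? -> ->.
exact: gdef_eq.
Qed.

Lemma sing_cup A B : sing A `|` sing B = sing (A `|` B).
Proof.
apply/seteqP; split=> C.
  by move=> [/singE[x Ax ->]|/singE[x Bx ->]]; apply/singE; exists x => //; [left|right].
by move=> /singE[x [Ax|Bx] ->]; [left|right]; apply/singE; exists x.
Qed.

Lemma dim_sing_cup A B : defg A -> defg B ->
  dim (sing (A `|` B)) = dim_max (dim (sing A)) (dim (sing B)).
Proof.
move=> dA dB; rewrite -sing_cup (dim_union dimP MT) //.
- exact: interpretable_sing.
- exact: interpretable_sing.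
- by rewrite sing_cup; apply: interpretable_sing; exact: defg_cup.
Qed.

Lemma dim_sing_le A B : defg A -> defg B -> A `<=` B ->
  dim_le (dim (sing A)) (dim (sing B)).
Proof.
move=> dA dB /setUidr AB; have := dim_sing_cup dA dB; rewrite AB => ->.
by rewrite /dim_max; case: ifP => // _; case: (dim _) => //= m.
Qed.

Lemma dim_sing1 x : dim (sing [set x]) = Some 0%N.
Proof.
have -> : sing [set x] = [set [set iota x]].
  apply/seteqP; split=> C; first by move=> /singE[_ -> ->].
  by move=> ->; apply/singE; exists x.
apply/(dim_finite dimP MT).
  have <- : sing [set x] = [set [set iota x]].
    apply/seteqP; split=> C; first by move=> /singE[_ -> ->].
    by move=> ->; apply/singE; exists x.
  by apply: interpretable_sing; exact: defg_set1.
by split; [exact: finite_set1|exists [set iota x]].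
Qed.

(** The axioms do not say outright that an infinite set has dimension other than -oo. It follows
    from the union axiom, since the set contains a singleton, of dimension 0. *)
Lemma dim_sing_neq0 A x : defg A -> A x -> dim_le (Some 0%N) (dim (sing A)).
Proof.
move=> dA Ax; rewrite -(dim_sing1 x); apply: dim_sing_le => //.
  exact: defg_set1.
by move=> _ ->.
Qed.

(** Interpretable functions act on classes, hence this form. On singletons it is x |-> [S x], which
    covers both definable maps, with [S] the graph, and projections to a quotient, with [S x] the
    class of x. *)
Definition rel_map (S : G -> G -> Prop) (C : set (n.-tuple M)) :=
  iota @` [set y | exists2 x, C (iota x) & S x y].

Lemma rel_map1 S x : rel_map S [set iota x] = iota @` (S x).
Proof.
apply/seteqP; split=> t.
  by move=> [y [x' /iotaI-> Sxy] <-]; exists y.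
by move=> [y Sxy <-]; exists y => //; exists x.
Qed.

Lemma interpretable_fun_rel A (Y : set (set (n.-tuple M))) S : defg A ->
    gdef (fun v : bool -> G => S (v true) (v false)) ->
    (forall x, A x -> Y (iota @` (S x))) ->
  interpretable_fun (sing A) Y (rel_map S).
Proof.
move=> dA dS AY; split=> [C /singE[x Ax ->]|]; first by rewrite rel_map1; exact: AY.
have -> : (fun x y => exists C, [/\ sing A C, C x & rel_map S C y]) =
    code_rel iota (fun x y => A x /\ S x y).
  apply: funext => t; apply: funext => u; apply/propext; split.
    move=> [_ [/singE[x Ax ->] -> ]]; rewrite rel_map1 => -[y Sxy <-].
    by exists x, y.
  move=> [x [y [-> -> [Ax Sxy]]]]; exists [set iota x]; split=> //.
    by apply/singE; exists x.
  by rewrite rel_map1; exists y.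
apply: definable_code_rel => //; apply: gdef_and => //.
exact: gdef_memv.
Qed.

(** The fibres are nonempty, hence of dimension at least 0, and the lower fibre axiom applies with
    [k = 0]. *)
Lemma dim_sing_surj A B (f : (unit -> G) -> G) : defg A -> defg B -> gfun f ->
    (forall x, A x -> B (f (fun=> x))) ->
    (forall y, B y -> exists2 x, A x & y = f (fun=> x)) ->
  dim_le (dim (sing B)) (dim (sing A)).
Proof.
move=> dA dB df fAB fsurj; pose S x y := y = f (fun=> x).
have dS : gdef (fun v : bool -> G => S (v true) (v false)).
  apply: gdef_eqf; first exact: gfun_var.
  exact: (@gfun_reindex _ _ _ _ _ unit bool (fun=> true) _ df).
have S1 x : iota @` (S x) = [set iota (f (fun=> x))].
  by apply/seteqP; split=> t; [move=> [_ -> <-]|move=> ->; exists (f (fun=> x))].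
have := @dim_fibre_ge _ _ _ dimP _ MT _ _ (sing A) (sing B) (rel_map S) 0%N.
have -> : dim_addn (dim (sing B)) 0 = dim (sing B).
  by case: (dim (sing B)) => //= m; rewrite addn0.
apply; [exact: interpretable_sing|exact: interpretable_sing| |].
  apply: interpretable_fun_rel => // x Ax; rewrite S1; apply/singE.
  by exists (f (fun=> x)) => //; exact: fAB.
move=> _ /singE[y By ->].
have [x Ax yx] := fsurj y By.
have -> : sing A `&` rel_map S @^-1` [set [set iota y]] =
    sing (A `&` [set x | y = f (fun=> x)]).
  apply/seteqP; split=> C.
    move=> [/singE[x' Ax' ->]]; rewrite /preimage /= rel_map1 S1 => E.
    apply/singE; exists x' => //; split=> //=; apply: iotaI.
    by have : [set iota y] (iota y) by []; rewrite -E.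
  move=> /singE[x' [Ax' /= yx'] ->]; split; first by apply/singE; exists x'.
  by rewrite /preimage /= rel_map1 S1 -yx'.
apply: (@dim_sing_neq0 _ x) => //; apply: defg_cap => //.
have -> : [set x | y = f (fun=> x)] = [set x | [set y] (f (fun=> x))].
  by apply/seteqP; split=> z /= ->.
exact: (defg_preim (defg_set1 y) df).
Qed.

(** The value on the empty set is the default 0. *)
Definition nd A := odflt 0%N (dim (sing A)).

Lemma dim_sing_nd A x : defg A -> A x -> dim (sing A) = Some (nd A).
Proof.
by move=> dA /(dim_sing_neq0 dA); rewrite /nd; case: (dim _).
Qed.

Lemma nd_mono A B : defg A -> defg B -> A `<=` B -> (nd A <= nd B)%N.
Proof.
move=> dA dB AB; have := dim_sing_le dA dB AB.
by rewrite /nd; case: (dim _) => [a|] //; case: (dim _).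
Qed.

Lemma nd_cup A B : defg A -> defg B -> (nd (A `|` B) <= maxn (nd A) (nd B))%N.
Proof.
move=> dA dB; rewrite /nd dim_sing_cup // /dim_max.
by case: ifP => _; rewrite leq_max leqnn ?orbT.
Qed.

(** * Cosets and the drop of the dimension at infinite index *)

Section Cosets.
Variables H N : set G.
Hypotheses (dH : defg H) (dN : defg N) (zH : zsub H) (zN : zsub N) (NH : N `<=` H).

Lemma gdef_coset : gdef (fun v : bool -> G => N (v true - v false)).
Proof.
by apply: (gdef_mem iotaI drange dN); apply: gfun_sub; exact: gfun_var.
Qed.

Lemma coset_refl x : N (x - x).
Proof. by rewrite subrr; exact: zN.1. Qed.

Lemma coset_sym x y : N (x - y) -> N (y - x).
Proof. by move=> /(zsubN zN); rewrite opprB. Qed.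

Lemma coset_trans x y z : N (x - y) -> N (y - z) -> N (x - z).
Proof. by move=> xy yz; rewrite -(subrKA y); exact: zsubD. Qed.

Lemma defg_coset x : defg [set y | H y /\ N (x - y)].
Proof.
apply: (defg_cap dH (B := [set y | N (x - y)])).
apply: (@defg_preim N (fun v => x - v tt)) => //.
by apply: gfun_sub; [exact: gfun_cst|exact: gfun_var].
Qed.

(** The map y |-> x - y exchanges [N] and the coset of x. Being its own inverse, it serves for both
    inequalities. *)
Lemma dim_coset x : H x -> dim (sing [set y | H y /\ N (x - y)]) = dim (sing N).
Proof.
move=> Hx; have df : gfun (fun v : unit -> G => x - v tt).
  by apply: gfun_sub; [exact: gfun_cst|exact: gfun_var].
have le1 : dim_le (dim (sing [set y | H y /\ N (x - y)])) (dim (sing N)).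
  apply: (dim_sing_surj dN (defg_coset x) df) => [y Ny|y [Hy Nxy]].
    by split; [apply: zH.2 => //; exact: NH|rewrite opprB addrC subrK].
  by exists (x - y); rewrite // opprB addrC subrK.
have le2 : dim_le (dim (sing N)) (dim (sing [set y | H y /\ N (x - y)])).
  apply: (dim_sing_surj (defg_coset x) dN df) => [y [Hy Nxy]//|y Ny].
  exists (x - y); last by rewrite opprB addrC subrK.
  by split; [apply: zH.2 => //; exact: NH|rewrite opprB addrC subrK].
move: le1 le2; case: (dim _) => [a|]; case: (dim _) => [b|] //= ab ba.
by congr Some; apply/eqP; rewrite eqn_leq ab.
Qed.

(** All fibres of the projection from [H] to the interpretable set H/N have dimension [nd N], so the
    two fibre axioms give dim H = dim(H/N) + dim N. A quotient of dimension 0 is finite. *)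
Lemma nd_lt : ~ ale H N -> (nd N < nd H)%N.
Proof.
move=> nale; pose R x y := N (x - y); pose S x y := H y /\ R x y.
have dR : gdef (fun v : bool -> G => R (v true) (v false)) := gdef_coset.
pose X := sing H; pose Y := classes H R.
have iX : interpretable X := interpretable_sing dH.
have iY : interpretable Y.
  apply: interpretable_classes => //; first exact: coset_refl.
    exact: coset_sym.
  exact: coset_trans.
have fXY : interpretable_fun X Y (rel_map S).
  apply: interpretable_fun_rel => //; first by apply: gdef_and => //; exact: gdef_memv.
  by move=> x Hx; apply/classesE; exists x.
have Ek := dim_sing_nd dN zN.1.
have fib y : Y y -> dim (X `&` rel_map S @^-1` [set y]) = Some (nd N).
  move=> /classesE[x Hx ->]; rewrite -Ek -(dim_coset Hx); congr dim.
  apply/seteqP; split=> C.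
    move=> [/singE[x' Hx' ->]]; rewrite /preimage /= rel_map1 => E.
    apply/singE; exists x' => //; split=> //.
    have : (iota @` S x') (iota x') by exists x' => //; split=> //; exact: coset_refl.
    by rewrite E => -[z [_ Rz] /iotaI <-].
  move=> /singE[x' [Hx' Rx'] ->]; split; first by apply/singE; exists x'.
  rewrite /preimage /= rel_map1; congr image; apply/seteqP; split=> z [Hz Rz]; split=> //.
    exact: coset_trans Rx' Rz.
  exact: coset_trans (coset_sym Rx') Rz.
have ge := dim_fibre_ge dimP MT iX iY fXY (k := nd N).
have le := dim_fibre_le dimP MT iX iY fXY (k := nd N).
have {}ge : dim_le (dim_addn (dim Y) (nd N)) (dim X).
  by apply: ge => y /fib ->; rewrite /= leqnn.
have {}le : dim_le (dim X) (dim_addn (dim Y) (nd N)).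
  by apply: le => y /fib ->; rewrite /= leqnn.
have EX := dim_sing_nd dH zH.1; rewrite -/X in EX.
rewrite EX in ge le.
(* The value -oo is excluded by [le], as [X] has a dimension in omega; a positive value gives the
   strict inequality; the value 0 remains, where [Y] is finite. *)
case EY: (dim Y) ge le => [[|m]|] //= ge le; last first.
  by rewrite (leq_trans _ ge) // addSn ltnS leq_addl.
have [[d /card_eqPle[/pcard_leP[f] _]] _] := (dim_finite dimP MT iY).1 EY.
case: nale.
pose cl x := iota @` [set y | H y /\ R x y].
have Ycl x : H x -> Y (cl x) by move=> Hx; apply/classesE; exists x.
apply: (@ale_colours G nat (fun h i => f (cl h) = i) (seq.iota 0 d)).
  move=> h Hh; exists (f (cl h)) => //.
  have := @funS _ _ _ _ f _ (Ycl h Hh); rewrite /= => lt.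
  by rewrite mem_iota.
move=> h h' i Hh Hh' Eh Eh'.
have /(@inj _ _ _ f) : f (cl h) = f (cl h') by rewrite Eh.
rewrite !inE => /(_ (Ycl _ Hh) (Ycl _ Hh')) E.
have : cl h' (iota h') by exists h' => //; split=> //; exact: coset_refl.
by rewrite -E => -[z [_ Rz] /iotaI <-].
Qed.

End Cosets.

(** The dimension takes the place of B. H. Neumann's covering lemma: each [N i] meets [H] in a set
    of smaller dimension, so finitely many of them cannot cover [H]. *)
Lemma avoid_finite_union (I : eqType) (s : seq I) (N : I -> set G) H :
    defg H -> zsub H ->
    (forall i, i \in s -> [/\ defg (N i), zsub (N i) & ~ ale H (N i)]) ->
  exists2 h, H h & forall i, i \in s -> ~ N i h.
Proof.
move=> dH zH sN; apply: contrapT => no.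
(* The alternative [U = set0] serves the empty family: [nd set0] is 0, which is not below [nd H]
   when [H] is finite. *)
have key : exists U, [/\ defg U, forall h, (exists2 i, i \in s & N i h) -> H h -> U h &
    U = set0 \/ (nd U < nd H)%N].
  elim: s sN {no} => [|i s IH] sN.
    by exists set0; split; [exact: defg_set0|move=> h []|left].
  have [j js|U [dU sU ltU]] := IH; first by apply: sN; rewrite inE js orbT.
  have [dN zN nN] := sN i (mem_head i s).
  have ltN : (nd (H `&` N i) < nd H)%N.
    apply: nd_lt => //; first exact: defg_cap.
    - split; first by split; [exact: zH.1|exact: zN.1].
      by move=> x y [? ?] [? ?]; split; [exact: zH.2|exact: zN.2].
    - by apply: contra_not nN => /ale_sub; apply.
  exists ((H `&` N i) `|` U); split.
  - by apply: defg_cup => //; exact: defg_cap.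
  - move=> h [j]; rewrite inE => /predU1P[->|js] Nj Hh; first by left.
    by right; apply: sU => //; exists j.
  - right; case: ltU => [->|ltU]; first by rewrite setU0.
    apply: leq_ltn_trans (nd_cup _ dU) _; first exact: defg_cap.
    by rewrite gtn_max ltN ltU.
have [U [dU sU ltU]] := key.
have HU : H `<=` U.
  move=> h Hh; apply: sU => //; apply: contrapT => no2; apply: no; exists h => // i si Ni.
  by apply: no2; exists i.
case: ltU => [U0|]; first by have := HU 0 zH.1; rewrite U0.
by rewrite ltnNge nd_mono.
Qed.

End Dimension.

(** * Ultrapowers and the uniform chain condition *)

Lemma free_ultrafilter : exists U : set_system nat, UltraFilter U /\ \oo `<=` U.
Proof. exact: ultraFilterLemma. Qed.

Definition ult (P : nat -> Prop) : Prop := sval (cid free_ultrafilter) [set k | P k].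

Section UltrafilterQuantifier.
Implicit Types P Q : nat -> Prop.

#[local] Instance ult_ultra : UltraFilter (sval (cid free_ultrafilter)).
Proof. by case: (svalP (cid free_ultrafilter)). Qed.

Lemma ult_mono P Q : (forall k, P k -> Q k) -> ult P -> ult Q.
Proof. by move=> PQ; exact: filterS. Qed.

Lemma ult_ext P Q : (forall k, P k <-> Q k) -> ult P <-> ult Q.
Proof. by move=> PQ; split; apply: ult_mono => k /PQ. Qed.

Lemma ult_ge k0 : ult (fun k => (k0 <= k)%N).
Proof.
have [_] := svalP (cid free_ultrafilter); apply.
by exists k0.
Qed.

Lemma ult_true P : (forall k, P k) -> ult P.
Proof. by move=> HP; apply: ult_mono (ult_ge 0) => k _. Qed.

Lemma ult_and P Q : ult (fun k => P k /\ Q k) <-> ult P /\ ult Q.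
Proof.
split=> [H|[HP HQ]]; last exact: filterI.
by split; apply: ult_mono H => k [].
Qed.

Lemma ult_exists P : ult P -> exists k, P k.
Proof. exact: filter_ex. Qed.

Lemma ult_not P : ult (fun k => ~ P k) <-> ~ ult P.
Proof.
split=> [HN HP|HN].
  have /ult_exists[k [? []]//] : ult (fun k => P k /\ ~ P k) by apply/ult_and.
by have [//|//] := in_ultra_setVsetC [set k | P k] ult_ultra.
Qed.

Lemma ult_imp P Q : ult (fun k => P k -> Q k) <-> (ult P -> ult Q).
Proof.
split=> [H HP|H].
  have : ult (fun k => (P k -> Q k) /\ P k) by apply/ult_and.
  by apply: ult_mono => k [PQ /PQ].
have [/H|/ult_not] := pselect (ult P); first exact: ult_mono.
by apply: ult_mono => k nP /nP.
Qed.

Lemma ult_all (I : finType) (P : I -> nat -> Prop) :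
  ult (fun k => forall i, P i k) <-> forall i, ult (P i).
Proof.
split=> [H i|H]; first by apply: ult_mono H.
exact: (@filter_forall _ I (fun i => [set k | P i k])).
Qed.

Lemma ult_ex (X : Type) (P : X -> nat -> Prop) : inhabited X ->
  ult (fun k => exists x, P x k) <-> exists f : nat -> X, ult (fun k => P (f k) k).
Proof.
move=> [x0]; split=> [H|[f]]; last by apply: ult_mono => k ?; exists (f k).
have /choice[f fP] : forall k, exists x, (exists y, P y k) -> P x k.
  move=> k; have [[x Px]|no] := pselect (exists y, P y k); first by exists x.
  by exists x0 => /no.
by exists f; exact: ult_mono H.
Qed.

End UltrafilterQuantifier.

(** * Ultrapowers of sets and groups *)

Definition upow (X : Type) :=
  {C : set (nat -> X) | exists f, C = [set h | ult (fun k => f k = h k)]}.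

Definition upi X (f : nat -> X) : upow X :=
  exist _ [set h | ult (fun k => f k = h k)] (ex_intro _ f erefl).

Lemma upiP X (f h : nat -> X) : upi f = upi h <-> ult (fun k => f k = h k).
Proof.
split=> [/(congr1 sval)/= E|fh].
  have : [set h' | ult (fun k => h k = h' k)] h by apply: ult_true.
  by rewrite -E.
apply: eq_exist => /=; apply/seteqP; split=> f' /= ff'.
  have : ult (fun k => f k = h k /\ f k = f' k) by apply/ult_and.
  by apply: ult_mono => k [<- <-].
have : ult (fun k => f k = h k /\ h k = f' k) by apply/ult_and.
by apply: ult_mono => k [-> <-].
Qed.

Lemma upi_surj X (c : upow X) : exists f, c = upi f.
Proof. by case: c => C [f Cf]; exists f; apply: eq_exist. Qed.

Definition urep X (c : upow X) : nat -> X := sval (cid (upi_surj c)).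

Lemma urepK X (c : upow X) : upi (urep c) = c.
Proof. by rewrite /urep; case: (cid _) => f /= ->. Qed.

Lemma upiK X (f : nat -> X) : ult (fun k => urep (upi f) k = f k).
Proof. by apply/upiP; rewrite urepK. Qed.

Lemma upi_fun I X (w : I -> upow X) : exists f : I -> nat -> X, w = (fun i => upi (f i)).
Proof. by exists (fun i => urep (w i)); apply: funext => i; rewrite urepK. Qed.

Section UltrapowerGroup.
Variable G : zmodType.

HB.instance Definition _ := gen_eqMixin (upow G).
HB.instance Definition _ := gen_choiceMixin (upow G).

Definition uadd (a b : upow G) : upow G := upi (fun k => urep a k + urep b k).
Definition uopp (a : upow G) : upow G := upi (fun k => - urep a k).

Lemma uaddE (f h : nat -> G) : uadd (upi f) (upi h) = upi (fun k => f k + h k).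
Proof.
apply/upiP; have : ult (fun k => urep (upi f) k = f k /\ urep (upi h) k = h k).
  by apply/ult_and; split; exact: upiK.
by apply: ult_mono => k [-> ->].
Qed.

Lemma uoppE (f : nat -> G) : uopp (upi f) = upi (fun k => - f k).
Proof. by apply/upiP; apply: ult_mono (upiK f) => k ->. Qed.

Lemma uaddA : associative uadd.
Proof.
move=> a b c; rewrite -[a]urepK -[b]urepK -[c]urepK !uaddE.
by congr upi; apply: funext => k; rewrite addrA.
Qed.

Lemma uaddC : commutative uadd.
Proof.
move=> a b; rewrite -[a]urepK -[b]urepK !uaddE.
by congr upi; apply: funext => k; rewrite addrC.
Qed.

Lemma uadd0 : left_id (upi (fun=> 0)) uadd.
Proof.
move=> a; rewrite -[a]urepK !uaddE.
by congr upi; apply: funext => k; rewrite add0r.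
Qed.

Lemma uaddN : left_inverse (upi (fun=> 0)) uopp uadd.
Proof.
move=> a; rewrite -[a]urepK uoppE !uaddE.
by congr upi; apply: funext => k; rewrite addNr.
Qed.

HB.instance Definition _ := GRing.isZmodule.Build (upow G) uaddA uaddC uadd0 uaddN.

Lemma upi0 : upi (fun=> 0 : G) = 0.
Proof. by []. Qed.

Lemma upiD (f h : nat -> G) : upi f + upi h = upi (fun k => f k + h k).
Proof. exact: uaddE. Qed.

Lemma upiB (f h : nat -> G) : upi f - upi h = upi (fun k => f k - h k).
Proof. by rewrite [- upi h]uoppE upiD. Qed.

End UltrapowerGroup.

(** * Transfer of truth and definability to the ultrapower *)

Section Los.
Variables (L : language) (M : structure L).

Lemma upow_inhabited : inhabited (upow M).
Proof. by have [m] := carrier_inhabited M; exists; exact: (upi (fun=> m)). Qed.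

(** Symbols are interpreted through chosen representatives; by [ult_urep_tuple] the choice is
    immaterial. *)
Definition ustruct : structure L := @Structure L (upow M) upow_inhabited
  (fun k f t => upi (fun i => fint f [tuple urep (tnth t j) i | j < k]))
  (fun k r t => ult (fun i => rint r [tuple urep (tnth t j) i | j < k])).

Lemma ult_urep_tuple k (v : 'I_k -> nat -> M) (t : k.-tuple (upow M)) :
    (forall j, tnth t j = upi (v j)) ->
  ult (fun i => [tuple urep (tnth t j) i | j < k] = [tuple v j i | j < k]).
Proof.
move=> tv; have : ult (fun i => forall j, urep (tnth t j) i = v j i).
  by apply/ult_all => j; rewrite tv; exact: upiK.
by apply: ult_mono => i E; apply: eq_from_tnth => j; rewrite !tnth_mktuple.
Qed.

Lemma eval_ustruct N (t : term L N) (v : 'I_N -> nat -> M) :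
  @eval L ustruct N [tuple upi (v i) | i < N] t =
  upi (fun k => eval [tuple v i k | i < N] t).
Proof.
elim: t => [i|k f u IH] /=.
  by rewrite tnth_mktuple; congr upi; apply: funext => j; rewrite tnth_mktuple.
apply/upiP.
have := @ult_urep_tuple k (fun j i => eval [tuple v i0 i | i0 < N] (u j))
  [tuple @eval L ustruct N [tuple upi (v i) | i < N] (u i) | i < k].
move=> /(_ (fun j => etrans (tnth_mktuple _ _) (IH j))).
by apply: ult_mono => i ->.
Qed.

Lemma mktuple_cons (X : Type) N (a : X) (v : 'I_N -> X) :
  cons_tuple a [tuple v i | i < N] =
  [tuple (if unlift ord0 i is Some j then v j else a) | i < N.+1].
Proof.
apply: eq_from_tnth => i; rewrite tnth_mktuple.
by case: unliftP => [j|] ->; rewrite ?tnthS ?tnth_mktuple ?tnth0.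
Qed.

Lemma los N (phi : formula L N) (v : 'I_N -> nat -> M) :
  @sat L ustruct N phi [tuple upi (v i) | i < N] <->
  ult (fun k => sat phi [tuple v i k | i < N]).
Proof.
elim: phi v => [{}N|{}N t u|{}N k r u|{}N p IHp q IHq|{}N p IHp] v /=.
- by split=> // /ult_exists[].
- by rewrite !eval_ustruct upiP.
- have E := @ult_urep_tuple k (fun j i => eval [tuple v i0 i | i0 < N] (u j))
    [tuple @eval L ustruct N [tuple upi (v i) | i < N] (u i) | i < k].
  have {}E := E (fun j => etrans (tnth_mktuple _ _) (eval_ustruct _ _)).
  split=> H.
    by have /ult_and := conj E H; apply: ult_mono => i [<-].
  by have /ult_and := conj E H; apply: ult_mono => i [->].
- by rewrite IHp IHq ult_imp.
- have IH a : @sat L ustruct N.+1 p (cons_tuple (upi a) [tuple upi (v i) | i < N]) <->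
      ult (fun k => sat p (cons_tuple (a k) [tuple v i k | i < N])).
    have := IHp (fun i => if unlift ord0 i is Some j then v j else a).
    rewrite mktuple_cons; set t1 := mktuple _; set t2 := mktuple _.
    have -> : t1 = t2 by apply: eq_from_tnth => i; rewrite !tnth_mktuple; case: unlift.
    move=> ->; apply: ult_ext => k; rewrite mktuple_cons.
    set t3 := mktuple _; set t4 := mktuple _.
    suff -> : t3 = t4 by [].
    by apply: eq_from_tnth => i; rewrite !tnth_mktuple; case: unlift.
  split=> [H|H c]; last first.
    by rewrite -[c]urepK; apply/IH; apply: ult_mono H => k; exact.
  apply: contrapT => /ult_not HN.
  have /(ult_ex _ (carrier_inhabited M))[a] :
      ult (fun k => exists a, ~ sat p (cons_tuple a [tuple v i k | i < N])).
    by apply: ult_mono HN => k /existsNP.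
  by move=> /ult_not; apply; exact/IH.
Qed.

Lemma models_ustruct (T : theory L) : models M T -> models ustruct T.
Proof.
move=> MT s Ts; have [m0] := carrier_inhabited M.
have := los s (fun=> fun=> m0); rewrite (tuple0 [tuple _ | _ < _]) => ->.
by apply: ult_true => k; rewrite (tuple0 [tuple _ | _ < _]); exact: MT.
Qed.

(** The parameters of [P] become constant sequences. *)
Lemma los_defin I (P : (I -> M) -> Prop) : defin P ->
  exists2 P' : (I -> ustruct) -> Prop, defin P' &
    forall w : I -> nat -> M,
      P' (fun i => upi (w i)) <-> ult (fun k => P (fun i => w i k)).
Proof.
move=> [N [phi [s sP]]].
pose s' (i : 'I_N) : I + ustruct :=
  match s i with inl j => inl j | inr a => inr (upi (fun=> a)) end.
exists (fun w => sat phi (assign s' w)); first by exists N, phi, s'.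
move=> w; have := los phi (fun i k => match s i with inl j => w j k | inr a => a end).
set t1 := mktuple _ => E.
have -> : assign s' (fun i => upi (w i) : ustruct) = t1.
  by apply: eq_from_tnth => i; rewrite !tnth_mktuple /s'; case: (s i).
by rewrite E; apply: ult_ext => k; rewrite sP.
Qed.

Variables (n : nat) (G : zmodType) (iota : G -> n.-tuple M).
Hypotheses (iotaI : injective iota) (drange : definable (range iota)).
Hypothesis dadd : gfun iota (fun v : bool -> G => v true + v false).

Definition uiota (c : upow G) : n.-tuple ustruct :=
  [tuple upi (fun k => tnth (iota (urep c k)) i) | i < n].

Lemma tnth_uiota f i : tnth (uiota (upi f)) i = upi (fun k => tnth (iota (f k)) i).
Proof. by rewrite tnth_mktuple; apply/upiP; apply: ult_mono (upiK f) => k ->. Qed.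

Lemma uiota_inj : injective uiota.
Proof.
move=> a b; have [f ->] := upi_surj a; have [h ->] := upi_surj b => E.
have : ult (fun k => forall i, tnth (iota (f k)) i = tnth (iota (h k)) i).
  apply/ult_all => i; apply/upiP; rewrite -!tnth_uiota E //.
move=> H; apply/upiP; apply: ult_mono H => k Ek; apply: iotaI.
exact: eq_from_tnth.
Qed.

Lemma uiota_range : definable (range uiota).
Proof.
have /definableP/los_defin[P dP PE] := drange.
apply/definableP; apply: defin_ext dP => w; have [u ->] := upi_fun w.
rewrite PE range_tuple; split=> [H|[c]].
  have {}H : ult (fun k => exists x, (fun i => u i k) = tnth (iota x)).
    by apply: ult_mono H => k /range_tuple.
  have [f fP] := (ult_ex _ (inhabits (0 : G))).1 H.
  exists (upi f); apply: funext => i; rewrite tnth_uiota; apply/upiP.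
  by apply: ult_mono fP => k E; rewrite -(congr1 (@^~ i) E).
have [f ->] := upi_surj c => E.
have : ult (fun k => forall i, u i k = tnth (iota (f k)) i).
  by apply/ult_all => i; apply/upiP; rewrite -tnth_uiota -(congr1 (@^~ i) E).
by apply: ult_mono => k Ek; apply/range_tuple; exists (f k); apply: funext.
Qed.

Lemma los_gdef V (R : (V -> G) -> Prop) : gdef iota R ->
  exists2 R' : (V -> upow G) -> Prop, gdef uiota R' &
    forall f : V -> nat -> G,
      R' (fun i => upi (f i)) <-> ult (fun k => R (fun i => f i k)).
Proof.
move=> [P /los_defin[P' dP' PE] RP].
exists (fun v => P' (coded uiota v)); first by exists P'.
move=> f; have -> : coded uiota (fun i => upi (f i)) =
    (fun q => upi (fun k => coded iota (fun i => f i k) q)).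
  by apply: funext => q; rewrite /coded tnth_uiota.
by rewrite PE; apply: ult_ext => k; rewrite RP.
Qed.

Lemma uiota_add : gfun uiota (fun v : bool -> upow G => v true + v false).
Proof.
have [R dR RE] := los_gdef dadd.
apply: gdef_ext dR => v; have [f ->] := upi_fun v.
by rewrite RE upiD upiP.
Qed.

Variables (T : theory L) (MT : models M T) (Tfd : finite_dimensional T).

Definition chain_cap X (R : X -> X -> Prop) (x : nat -> X) i : set X :=
  [set y | forall j, (j < i)%N -> R (x j) y].

(* Otherwise chains with larger and larger indices would yield, in the ultrapower,
   a chain of infinite indices longer than the dimension. *)
Lemma uniform_chain_condition (R : G -> G -> Prop) :
    gdef iota (fun v : bool -> G => R (v true) (v false)) ->
    (forall x, zsub (R x)) ->
  exists d m, forall x : nat -> G,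
    ~ (forall i, (i < m)%N -> separated (chain_cap R x i) (R (x i)) d).
Proof.
move=> /los_gdef[R' dR' R'E] zR; have [dim dimP] := Tfd.
pose S a b := R' (fun c : bool => if c then a else b).
have SE f h : S (upi f) (upi h) <-> ult (fun k => R (f k) (h k)).
  rewrite -(R'E (fun c => if c then f else h)) /S.
  by have -> : (fun c : bool => if c then upi f else upi h) =
    (fun c : bool => upi (if c then f else h)) by apply: funext => -[].
have dS : gdef uiota (fun v : bool -> upow G => S (v true) (v false)).
  by apply: gdef_ext dR' => v; rewrite /S; have -> : (fun c : bool =>
    if c then v true else v false) = v by apply: funext => -[].
have zS a : zsub (S a).
  rewrite -[a]urepK; split.
    by rewrite -upi0; apply/SE; apply: ult_true => k; exact: (zR _).1.
  move=> b c; rewrite -[b]urepK -[c]urepK upiB => /SE Sb /SE Sc; apply/SE.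
  have /ult_and := conj Sb Sc; apply: ult_mono => k [Rb Rc]; exact: (zR _).2.
(* One more than the dimension of the ultrapower of [G], so that [m] successive drops are
   impossible. This dimension makes sense because [ustruct] is again a model of [T]. *)
pose m := (@nd L dim ustruct n (upow G) uiota setT).+1.
apply: contrapT => no.
have /choice[X XP] : forall d, exists x : nat -> G,
    forall i, (i < m)%N -> separated (chain_cap R x i) (R (x i)) d.
  move=> d; apply: contrapT => nd; apply: no; exists d, m => x xP.
  by apply: nd; exists x.
have /choice[Y YP] : forall p : nat * nat, exists y : nat -> G, (p.2 < m)%N ->
    (forall i, (i < p.1)%N -> chain_cap R (X p.1) p.2 (y i)) /\
    (forall i j, (i < j)%N -> (j < p.1)%N -> ~ R (X p.1 p.2) (y j - y i)).
  move=> [d i]; case: (ltnP i m) => im; last by exists (fun=> 0).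
  by have [y yP] := XP d i im; exists y.
pose xs i : upow G := upi (fun d => X d i).
pose ys i j : upow G := upi (fun d => Y (d, i) j).
pose N i := chain_cap S xs i.
have zN i : zsub (N i).
  split=> [j _|a b Na Nb j ji]; first exact: (zS _).1.
  by apply: (zS _).2; [exact: Na|exact: Nb].
have NS i : N i.+1 = N i `&` S (xs i).
  apply/seteqP; split=> a.
    by move=> Na; split; [move=> j ji; apply: Na; exact: ltnW|exact: Na].
  move=> [Na Sa] j; rewrite ltnS leq_eqVlt => /predU1P[->//|]; exact: Na.
have N0 : N 0%N = setT by apply/seteqP; split.
have dSx a : defg uiota (S a).
  apply: (defg_gdef uiota_inj uiota_range).
  have := @gdef_reindex _ _ _ _ uiota _ (option unit) (fun c : bool =>
    if c then None else Some tt) _ dS.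
  by move=> /(gdef_param a).
have dN i : defg uiota (N i).
  elim: i => [|i IH]; first by rewrite N0; exact: uiota_range.
  rewrite NS; exact: (defg_cap uiota_inj uiota_range).
have ysN i j : (i < m)%N -> N i (ys i j).
  (* For d > j the element [Y (d, i) j] is a member of the separated family of length d; the
     finitely many other coordinates do not count. *)
  move=> im l li; apply/SE; apply: ult_mono (ult_ge j.+1) => d jd.
  exact: ((YP (d, i) im).1 j jd l li).
have ysS i j j' : (i < m)%N -> (j < j')%N -> ~ S (xs i) (ys i j' - ys i j).
  move=> im jj'; rewrite upiB => /SE H.
  have /ult_and/ult_exists[d [jd]] := conj (ult_ge j'.+1) H.
  exact: ((YP (d, i) im).2 j j' jj' jd).
have drop i : (i < m)%N ->
    (@nd L dim ustruct n (upow G) uiota (N i.+1) <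
     @nd L dim ustruct n (upow G) uiota (N i))%N.
  move=> im; apply: (nd_lt dimP (models_ustruct MT) uiota_inj uiota_range uiota_add) => //.
    by rewrite NS => a [].
  move=> /(ale_sub (fun a Na => Na) (_ : N i.+1 `<=` S (xs i))) H.
  apply: (infinite_separated_Nale (zS (xs i)) (y := ys i) (H := N i)).
  - by move=> j; exact: ysN.
  - by move=> j j'; exact: ysS.
  - by apply: H; rewrite NS => a [].
have bound i : (i <= m)%N ->
    (@nd L dim ustruct n (upow G) uiota (N i) + i < m)%N.
  elim: i => [|i IH] im; first by rewrite N0 addn0.
  rewrite addnS; have := IH (ltnW im); have := drop i im; lia.
by have := bound m (leqnn m); rewrite ltnNge leq_addl.
Qed.

End Los.

(** * The Fitting ideal *)

Section Fitting.
Variables (L : language) (T : theory L).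
Variable dim : forall (M : structure L) n, set (set (n.-tuple M)) -> dimension.
Hypothesis dimP : dimension_axioms T dim.
Variables (M : structure L) (g : lieRing) (n : nat) (iota : g -> n.-tuple M).
Hypotheses (MT : models M T) (lie_def : definable_lie iota).

Let iotaI : injective iota := iota_inj lie_def.
Let drange : definable (range iota) := definable_carrier lie_def.
Let dadd : gfun iota (fun v : bool -> g => v true + v false) :=
  gfun_op_graph iotaI (definable_add lie_def).
Let dbr : gfun iota (fun v : bool -> g => br (v true) (v false)) :=
  gfun_op_graph iotaI (definable_br lie_def).

Notation gdef := (gdef iota).
Notation gfun := (gfun iota).
Notation defg := (defg iota).
Notation nd := (nd dim iota).
Notation F := (fitting g).
Implicit Types (A B E H I K N P X : set g).

Lemma gfun_br V (f h : (V -> g) -> g) : gfun f -> gfun h ->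
  gfun (fun v => br (f v) (h v)).
Proof. exact: (gfun_op2 drange dbr). Qed.

Lemma defg_ale A N : defg A -> zsub N -> A `<=` N -> ale N A -> defg N.
Proof.
move=> dA zN AN [s sc].
have dU (l : seq g) : defg [set y | exists2 r, r \in l & A (y - r)].
  elim: l => [|a l IH].
    have -> : [set y | exists2 r, r \in [::] & A (y - r)] = set0.
      by apply/seteqP; split=> y // [].
    exact: defg_set0.
  have -> : [set y | exists2 r, r \in a :: l & A (y - r)] =
      [set y | A (y - a)] `|` [set y | exists2 r, r \in l & A (y - r)].
    apply/seteqP; split=> y /=.
      by move=> [r]; rewrite inE => /predU1P[->|rl] Ar; [left|right; exists r].
    by move=> [Ay|[r rl Ar]]; [exists a|exists r]; rewrite ?inE ?eqxx ?rl ?orbT.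
  apply: (defg_cup iotaI drange) => //.
  apply: (defg_preim iotaI drange (f := fun v => v tt - a)) => //.
  by apply: (gfun_sub iotaI drange dadd); [exact: gfun_var|exact: gfun_cst].
have -> : N = [set y | exists2 r, r \in [seq r <- s | `[< N r >]] & A (y - r)].
  apply/seteqP; split=> y.
    move=> Ny; have [r rs Ar] := sc y Ny; exists r => //.
    rewrite mem_filter rs andbT; apply/asboolP.
    by rewrite -(subKr y r); apply: zN.2 => //; exact: AN.
  move=> [r]; rewrite mem_filter => /andP[/asboolP Nr _] /AN Nyr.
  by rewrite -(subrK r y); exact: zsubD.
exact: dU.
Qed.

(** * Almost centralizers modulo a definable ideal *)

Section ModuloIdeal.
Variable A : set g.
Hypotheses (iA : ideal A) (dA : defg A).

Let zA : zsub A := iA.1.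

Definition cent x : set g := [set y | A (br x y)].

Lemma cent_sym x y : cent x y -> cent y x.
Proof. by move=> /(zsubN zA); rewrite /cent /= br_antisym opprK. Qed.

Lemma cent_zsub x : zsub (cent x).
Proof.
split=> [|y z Cy Cz]; rewrite /cent /=; first by rewrite br0r; exact: zA.1.
by rewrite brBr; exact: zA.2.
Qed.

Lemma centB x x' y : cent x y -> cent x' y -> cent (x - x') y.
Proof. by move=> Cx Cx'; rewrite /cent /= brBl; exact: zA.2. Qed.

Lemma gdef_cent V (f h : (V -> g) -> g) : gfun f -> gfun h ->
  gdef (fun v => cent (f v) (h v)).
Proof. by move=> df dh; apply: (gdef_mem iotaI drange dA); exact: gfun_br. Qed.

Lemma defg_cent_seq (l : seq g) : defg [set y | forall z, z \in l -> cent z y].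
Proof.
elim: l => [|a l IH].
  have -> : [set y | forall z, z \in [::] -> cent z y] = setT by apply/seteqP; split.
  exact: drange.
have -> : [set y | forall z, z \in a :: l -> cent z y] =
    cent a `&` [set y | forall z, z \in l -> cent z y].
  apply/seteqP; split=> y /=.
    by move=> H; split=> [|z zl]; apply: H; rewrite inE ?eqxx ?zl ?orbT.
  by move=> [Ca H] z; rewrite inE => /predU1P[->|/H].
apply: (defg_cap iotaI drange) => //; apply: (defg_gdef iotaI drange).
by apply: gdef_cent; [exact: gfun_cst|exact: gfun_var].
Qed.

Lemma cent_seq_zsub (l : seq g) : zsub [set y | forall z, z \in l -> cent z y].
Proof.
split=> [z _|y y' Cy Cy' z zl]; first exact: (cent_zsub z).1.
by apply: (cent_zsub z).2; [exact: Cy|exact: Cy'].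
Qed.

(** Otherwise every list in [X] could be extended by an element of [X] whose centralizer has too
    large an index, against the uniform chain condition. [X] need not be definable, so that the
    lemma applies to the Fitting ideal and to almost centralizers. *)
Lemma centralizer_chain H X : exists (l : seq g) d, (forall z, z \in l -> X z) /\
  forall x, X x -> alen (H `&` [set y | forall z, z \in l -> cent z y]) (cent x) d.
Proof.
have [||d [m ucc]] := @uniform_chain_condition L M n g iota iotaI drange dadd T MT
    (ex_intro _ dim dimP) (fun x y => cent x y).
- by apply: gdef_cent; exact: gfun_var.
- exact: cent_zsub.
apply: contrapT => no.
have /choice[f fP] : forall l : seq g, exists x, (forall z, z \in l -> X z) -> X x /\
    separated (H `&` [set y | forall z, z \in l -> cent z y]) (cent x) d.
  move=> l; have [lX|nlX] := pselect (forall z, z \in l -> X z); last by exists 0.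
  apply: contrapT => nx; apply: no; exists l, d; split=> // x Xx.
  by apply: Nseparated_alen => sep; apply: nx; exists x.
pose l k := iter k (fun s => f s :: s) [::].
have lX k : forall z, z \in l k -> X z.
  elim: k => // k IH z; rewrite inE => /predU1P[->|/IH//].
  exact: (fP _ IH).1.
have fl i j : (i < j)%N -> f (l i) \in l j.
  elim: j => // j IH; rewrite ltnS leq_eqVlt => /predU1P[->|/IH ij].
    exact: mem_head.
  by rewrite /= inE ij orbT.
have lf i z : z \in l i -> exists2 j, (j < i)%N & z = f (l j).
  elim: i => // i IH; rewrite inE => /predU1P[->|/IH[j ji ->]]; first by exists i.
  by exists j => //; exact: ltnW.
apply: (ucc (fun i => f (l i))) => i _.
apply: separated_sub (fP (l i) (lX i)).2 => // y [_ Cy] j ji.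
by apply: Cy; exact: fl.
Qed.

(** The almost centralizer of [H] modulo [A]. As it stands it is not first-order, since the finite
    index carries no bound. *)
Definition acent H : set g := [set x | ale H (cent x)].

Lemma acent_zsub H : zsub (acent H).
Proof.
split=> [|x y Cx Cy].
  apply: (@ale_sub _ H H setT) => // [y _|]; last exact: ale_refl.
  by apply: cent_sym; exact: (cent_zsub y).1.
apply: ale_sub (ale_capI (cent_zsub x) (cent_zsub y) Cx Cy) => // z [Cxz Cyz].
exact: centB.
Qed.

Lemma acent_sub H H' : H `<=` H' -> acent H' `<=` acent H.
Proof. by move=> HH' x; exact: ale_sub. Qed.

Lemma ideal_sub_acent H : A `<=` acent H.
Proof.
move=> x Ax; apply: (@ale_sub _ H H setT) => // [y _|]; last exact: ale_refl.
exact: ideall.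
Qed.

(** The chain condition is applied to [acent H] itself. The centralizer of the finite list [l] has
    finite index in [H], witnessed by [s], and every [cent x] has index at most [d] in it. *)
Lemma acent_bounded H : zsub H -> exists D, forall x, acent H x -> alen H (cent x) D.
Proof.
move=> zH; have [l [d [lH lP]]] := centralizer_chain H (acent H).
have [s sc] : ale H (H `&` [set y | forall z, z \in l -> cent z y]).
  apply: ale_capI => //; first exact: cent_seq_zsub.
    by apply: ale_refl => //; exact: zH.1.
  by apply: ale_cap_seq => z /lH; split=> //; exact: cent_zsub.
exists (size s * d)%N => x /lP[t td tc].
exists [seq r + q | r <- s, q <- t]; first by rewrite size_allpairs td.
exact: covers_trans sc tc.
Qed.

Lemma gdef_covers H V (x : V) (l : seq V) : defg H ->
  gdef (fun v => covers (map v l) H (cent (v x))).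
Proof.
move=> dH.
apply: (gdef_all drange (R := fun w => H (w None) ->
  exists2 r, r \in map (fun i => w (Some i)) l & cent (w (Some x)) (w None - r))).
apply: gdef_imp; first exact: gdef_memv.
elim: l => [|a l IH].
  by apply: gdef_ext (gdef_false _ _) => w; split=> // -[].
apply: gdef_ext (gdef_or (gdef_cent (gfun_var iotaI (Some x))
  (gfun_sub iotaI drange dadd (gfun_var iotaI None) (gfun_var iotaI (Some a)))) IH) => w.
split.
  by move=> [C|[r rl C]]; [exists (w (Some a))|exists r]; rewrite //= inE ?eqxx ?rl ?orbT.
by move=> [r]; rewrite /= inE => /predU1P[->|rl] C; [left|right; exists r].
Qed.

(** In the generalisation, [l] holds the labels of representatives that are already quantified; each
    induction step on [d] turns one more into a fresh label. *)
Lemma gdef_alen H V (x : V) d : defg H -> gdef (fun v => alen H (cent (v x)) d).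
Proof.
move=> dH; suff key (l : seq V) : gdef (fun v => exists2 s, size s = d &
    covers (s ++ map v l) H (cent (v x))).
  apply: gdef_ext (key [::]) => v.
  by split=> -[s sd sc]; exists s => //; move: sc; rewrite /= cats0.
elim: d V x l => [|d IH] V x l.
  apply: gdef_ext (gdef_covers x l dH) => v; split=> [c|[s /size0nil->//]].
  by exists [::].
apply: gdef_ext (gdef_ex drange (IH _ (Some x) (None :: map Some l))) => v.
have E a : map (ext v a) (None :: map Some l) = a :: map v l by rewrite /= -map_comp.
split=> [[a [s sd]]|[s]].
  by rewrite E => c; exists (rcons s a); rewrite ?size_rcons ?sd ?cat_rcons.
case/lastP: s => // s a; rewrite size_rcons cat_rcons => -[sd] c.
by exists a; exists s; rewrite ?E.
Qed.

Lemma defg_acent H : zsub H -> defg H -> defg (acent H).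
Proof.
move=> zH dH; have [D DP] := acent_bounded zH.
have -> : acent H = [set x | alen H (cent x) D].
  by apply/seteqP; split=> x; [exact: DP|exact: alen_ale].
by apply: (defg_gdef iotaI drange); exact: gdef_alen.
Qed.

(** Otherwise there are [D.+1] elements of [K] whose differences all have centralizers of infinite
    index in [H]. Some h in [H] avoids these finitely many centralizers, and then [cent h] has index
    above [D] in [K]; but [D] bounds this index uniformly for h in [acent K]. *)
Lemma acent_symmetry H K : zsub H -> defg H -> zsub K -> defg K ->
  H `<=` acent K -> ale K (acent H).
Proof.
move=> zH dH zK dK HK; apply: contrapT => nale.
have [D DP] := acent_bounded zK.
have [y [yK ysep]] := Nale_separated D.+1 nale.
pose pairs :=
  [seq p <- [seq (i, j) | i <- seq.iota 0 D.+1, j <- seq.iota 0 D.+1] | (p.1 < p.2)%N].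
have mem_pairs i j : (i < j)%N -> (j < D.+1)%N -> (i, j) \in pairs.
  move=> ij jD; rewrite mem_filter ij andTb; apply/allpairsP; exists (i, j).
  by rewrite !mem_iota /= (ltn_trans ij jD) jD.
have [|h Hh hP] := avoid_finite_union dimP MT iotaI drange dadd (s := pairs)
    (N := fun p => cent (y p.2 - y p.1)) dH zH.
  move=> [i j]; rewrite mem_filter => /andP[ij].
  move=> /allpairsP[[i' j'] [_ + [_ jE]]]; rewrite -jE mem_iota add0n => /= jD.
  split; last exact: (ysep i j ij jD).
    apply: (defg_gdef iotaI drange).
    by apply: gdef_cent; [exact: gfun_cst|exact: gfun_var].
  exact: cent_zsub.
have [s sD sc] := DP h (HK h Hh).
have := @separated_le _ K (cent h) D.+1 s (cent_zsub h) sc.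
rewrite sD ltnn => contra; suff: false by []. apply: contra.
exists y; split=> // i j ij jD /cent_sym; exact: (hP (i, j) (mem_pairs i j ij jD)).
Qed.

(** By Jacobi [[y, v], x] = [y, [v, x]] - [v, [y, x]], so [y, v] commutes modulo [A] with each x
    such that v commutes with x and with [y, x]. The second condition has finite index only where
    [y, x] stays in [H], that is, on [H']. *)
Lemma acent_ideal H H' : zsub H -> H' `<=` H -> ale H H' ->
  (forall x y, H' x -> H (br y x)) -> ideal (acent H).
Proof.
move=> zH H'H HH' brH; split=> [|y v Cv]; first exact: acent_zsub.
apply: ale_trans HH' _.
have c1 : ale H' (cent v) by exact: ale_sub Cv.
have c2 : ale H' (fun x => cent v (br y x)).
  apply: (ale_hom (cent_zsub v) (brBr y)) Cv => x; exact: brH.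
have z2 : zsub (fun x => cent v (br y x)).
  split=> [|x x' Cx Cx']; rewrite ?br0r ?brBr; first exact: (cent_zsub v).1.
  exact: (cent_zsub v).2.
apply: ale_sub (ale_capI (cent_zsub v) z2 c1 c2) => // x [Cx Cyx]; rewrite /cent /=.
have -> : br (br y v) x = br y (br v x) - br v (br y x) by rewrite br_br addrK.
by apply: zA.2; [exact: iA.2|exact: Cyx].
Qed.

(* The bilinear form of the theorem of B. H. Neumann on groups whose conjugacy
   classes have bounded size: perturbing an [x] whose image [br x B] is of maximal
   size by a [z] killing the preimages of that image does not change the image. *)
Lemma bounded_bracket_finite P B : zsub P -> zsub B -> P `<=` acent B ->
    B `<=` acent P ->
  exists t : seq g, forall x v, P x -> B v -> exists2 r, r \in t & A (br x v - r).
Proof.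
move=> zP zB PB BP; have [D DP] := acent_bounded zB.
pose Q m := `[< exists2 x, P x & separated B (cent x) m >].
have Q0 : exists m, Q m.
  exists 0%N; apply/asboolP; exists 0; first exact: zP.1.
  by exists (fun=> 0).
have QD m : Q m -> (m <= D)%N.
  move=> /asboolP[x Px sep]; have [s sD sc] := DP x (PB x Px).
  by rewrite -sD; exact: separated_le (cent_zsub x) sc sep.
have [m /asboolP[x Px [y [yB ysep]]] mmax] := ex_maxnP Q0 QD.
pose l := map y (seq.iota 0 m).
have lP z : z \in l -> exists2 i, (i < m)%N & z = y i.
  by move=> /mapP[i]; rewrite mem_iota => /= im ->; exists i.
have yl i : (i < m)%N -> y i \in l by move=> im; apply: map_f; rewrite mem_iota.
have key z v : P z -> (forall i, (i < m)%N -> cent z (y i)) -> B v ->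
    exists2 i, (i < m)%N & cent (x + z) (v - y i).
  move=> Pz Cz Bv; apply: contrapT => no.
  have : Q m.+1.
    apply/asboolP; exists (x + z); first exact: zsubD.
    exists (fun i => if (i < m)%N then y i else v); split.
      by move=> i _; case: ifP => // /yB.
    move=> i j ij; rewrite ltnS leq_eqVlt => /predU1P[jm|jm].
      by rewrite jm ltnn -jm ij => C; apply: no; exists i; rewrite -?jm.
    have im := ltn_trans ij jm; rewrite jm im => C; apply: (ysep i j ij jm).
    rewrite -[x](addrK z); apply: centB => //.
    by apply: (cent_zsub z).2; exact: Cz.
  by move/mmax; rewrite ltnn.
have [s sc] : ale P (P `&` [set z | forall w, w \in l -> cent w z]).
  apply: ale_capI => //; first exact: cent_seq_zsub.
    by apply: ale_refl => //; exact: zP.1.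
  apply: ale_cap_seq => w /lP[i im ->]; split; first exact: cent_zsub.
  by apply: BP; exact: yB.
have /choice[u uP] : forall r, exists u, P r -> covers u B (cent r).
  move=> r; have [Pr|nPr] := pselect (P r); last by exists [::].
  by have [u uP] := PB r Pr; exists u.
(* Write z = r + w with r in [s] and w centralizing [l]. Modulo [A], [r, v] is one of the elements
   of [t1], while [w, v] = [x + w, v] - [x, v] is congruent to [x, y i] - [x, y j], an element of
   [t0]. *)
pose t0 := [seq br x v - br x w | v <- l, w <- l].
pose t1 := flatten [seq [seq br r q | q <- u r] | r <- s].
exists [seq a + b | a <- t0, b <- t1] => z v Pz Bv.
have [r rs [Pzr Czr]] := sc z Pz.
have Pr : P r by rewrite -(subKr z r); exact: zP.2.
have [q qu Cq] := uP r Pr v Bv.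
have Cl i : (i < m)%N -> cent (z - r) (y i).
  by move=> im; apply: cent_sym; apply: Czr; exact: yl.
have [i im Ci] := key (z - r) v Pzr Cl Bv.
have C0 k : (k < m)%N -> cent 0 (y k).
  by move=> _; apply: cent_sym; exact: (cent_zsub _).1.
have [j jm Cj] := key 0 v zP.1 C0 Bv.
exists ((br x (y i) - br x (y j)) + br r q).
  apply: allpairs_f; first by apply: allpairs_f; exact: yl.
  by apply/flattenP; exists [seq br r q | q <- u r]; exact: map_f.
have e1 w : br (x + w) (v - y i) + br w (y i) = br x v - br x (y i) + br w v.
  by rewrite brBr !brDl opprD addrACA addrA subrK.
set w := z - r.
have e3 : br w v + br r (v - q) = br z v - br r q by rewrite brBl brBr addrA subrK.
have -> : br z v - (br x (y i) - br x (y j) + br r q) =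
    br (x + w) (v - y i) + br w (y i) - br (x + 0) (v - y j) + br r (v - q).
  have ab (p a b c : g) : p - a + c - (p - b) = c - (a - b).
    by rewrite !opprB [LHS]addrC addrA subrKA addrC.
  rewrite e1 addr0 [br x (v - y j)]brBr ab [RHS]addrAC e3 -[RHS]addrA -opprD.
  by rewrite [br r q + _]addrC.
apply: zsubD => //; apply: zA.2 => //; apply: zsubD => //; exact: Cl.
Qed.

(* The classes of [br P B] modulo [A] are finitely many and each lies in a finite
   group [br x B], so finitely many such groups have a finite sum. *)
Lemma bracket_finite_ideal P B : ideal P -> ideal B -> P `<=` acent B ->
    B `<=` acent P ->
  exists N, [/\ ideal N, ale N A, A `<=` N & forall x v, P x -> B v -> N (br x v)].
Proof.
move=> iP iB PB BP; have zP := iP.1; have zB := iB.1.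
have [t tP] := bounded_bracket_finite zP zB PB BP.
(* [X r] has a bracket with [B] in the class of r if some element of [P] has one; otherwise any
   element of [P] will do. *)
have /choice[X XP] : forall r, exists x, P x /\
    ((exists y v, [/\ P y, B v & A (br y v - r)]) -> exists2 v, B v & A (br x v - r)).
  move=> r; have [[y [v [Py Bv Ar]]]|no] :=
    pselect (exists y v, [/\ P y, B v & A (br y v - r)]).
    by exists y; split=> // _; exists v.
  by exists 0; split=> [|/no//]; exact: zP.1.
(* [S l] is the sum of [A] and of the groups [x, B] for x in [l]. *)
pose fix S (l : seq g) : set g := if l is x :: l' then
  [set y | exists2 v, B v & S l' (y - br x v)] else A.
have zS l : zsub (S l).
  elim: l => //= x l IH; split.
    by exists 0; [exact: zB.1|rewrite br0r subr0; exact: IH.1].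
  move=> y y' [v Bv Sv] [v' Bv' Sv']; exists (v - v'); first exact: zB.2.
  by rewrite brBr opprD addrACA -opprD; exact: IH.2.
have AS l : A `<=` S l.
  elim: l => //= x l IH y Ay; exists 0; first exact: zB.1.
  by rewrite br0r subr0; exact: IH.
have Sl l x v : x \in l -> B v -> S l (br x v).
  elim: l => //= x' l IH; rewrite inE => /predU1P[->|xl] Bv.
    by exists v => //; rewrite subrr; exact: (zS l).1.
  by exists 0; [exact: zB.1|rewrite br0r subr0; exact: IH].
have aleS l : (forall x, x \in l -> P x) -> ale (S l) A.
  elim: l => [_|x l IH lP]; first by apply: ale_refl => //; exact: zA.1.
  have [s sc] : ale (S l) A by apply: IH => y yl; apply: lP; rewrite inE yl orbT.
  have [u uc] : ale B (cent x) by apply: PB; apply: lP; exact: mem_head.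
  exists [seq br x q + r | q <- u, r <- s] => y [v Bv /sc[r rs Ar]].
  have [q qu Cq] := uc v Bv; exists (br x q + r); first exact: allpairs_f.
  have -> : y - (br x q + r) = y - br x v - r + br x (v - q).
    by rewrite brBr addrACA subrK -opprD [r + _]addrC.
  exact: zsubD.
pose l := map X t.
have lP x : x \in l -> P x by move=> /mapP[r _ ->]; case: (XP r).
have PBS x v : P x -> B v -> S l (br x v).
  move=> Px Bv; have [r rt Ar] := tP x v Px Bv.
  have [_ [|w Bw Aw]] := XP r; first by exists x, v.
  have -> : br x v = br (X r) w + ((br x v - r) - (br (X r) w - r)).
    by rewrite opprB subrKA [RHS]addrC subrK.
  apply: zsubD => //; first by apply: Sl => //; exact: map_f.
  by apply: AS; exact: zA.2.
exists (S l); split; [|exact: aleS|exact: AS|exact: PBS].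
split=> [|z]; first exact: (zS l).
(* The induction runs over sublists [l'] while the conclusion stays in [S l]: by Jacobi [z, [x, v]]
   is a sum of two brackets of [P] with [B], and these are known to lie in the full sum only. *)
have: {subset l <= l} by [].
elim: {1 3}l => [|x l' IH] l'l y; first by move=> Ay; apply: AS; exact: iA.2.
move=> [v Bv Sv]; rewrite -[y](subrK (br x v)) brDr; apply: zsubD => //.
  by apply: IH => // x' x'l; apply: l'l; rewrite inE x'l orbT.
have Px : P x by apply: lP; apply: l'l; exact: mem_head.
by rewrite br_br; apply: zsubD => //; apply: PBS => //; [exact: iP.2|exact: iB.2].
Qed.

Definition annihilator N : set g := [set x | forall v, N v -> A (br x v)].

Lemma annihilator_ideal N : ideal N -> ideal (annihilator N).
Proof.
move=> iN; split; first split.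
- by move=> v _; apply: cent_sym; rewrite /cent /= br0r; exact: zA.1.
- by move=> x y Kx Ky v Nv; rewrite brBl; apply: zA.2; [exact: Kx|exact: Ky].
- move=> y x Kx v Nv.
  have -> : br (br y x) v = br y (br x v) - br x (br y v) by rewrite br_br addrK.
  by apply: zA.2; [apply: iA.2; exact: Kx|apply: Kx; exact: iN.2].
Qed.

Lemma defg_annihilator N : defg N -> defg (annihilator N).
Proof.
move=> dN; apply: (defg_gdef iotaI drange).
apply: (gdef_all drange (R := fun w => N (w None) -> cent (w (Some tt)) (w None))).
apply: gdef_imp; first exact: gdef_memv.
by apply: gdef_cent; exact: gfun_var.
Qed.

(** Finitely many representatives r of [N] modulo [A] suffice. Each centralizer has finite index, as
    x |-> [r, x] maps g into [N], which is finite modulo [A]. *)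
Lemma ale_annihilator N : ideal N -> A `<=` N -> ale N A -> ale setT (annihilator N).
Proof.
move=> iN AN aN; have [s sc] := aN.
pose s' := [seq r <- s | `[< N r >]].
apply: (@ale_sub _ setT setT [set x | forall r, r \in s' -> cent r x]) => //; last first.
  apply: ale_cap_seq => r; rewrite mem_filter => /andP[/asboolP Nr _].
  split; first exact: cent_zsub.
  apply: (ale_hom zA (brBr r)) aN => x _.
  by rewrite br_antisym; apply: (zsubN iN.1); exact: iN.2.
move=> x Cx v Nv; have [r rs Ar] := sc v Nv.
rewrite -(subrK r v) brDr; apply: zsubD => //; first exact: iA.2.
apply: cent_sym; apply: Cx; rewrite mem_filter rs andbT; apply/asboolP.
by rewrite -(subKr v r); apply: iN.1.2 => //; exact: AN.
Qed.

(** Suppose the centralizer of [l] is finite modulo [A]. By induction on j, so is the set of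
    elements carried into [A] by any j brackets with members of [l]: each member maps this set into
    the previous one, and the common kernel modulo [A] is that centralizer. If k brackets with [I]
    kill g, the set for j = k is all of g. *)
Lemma centralizer_not_small (l : seq g) : ~ ale setT A ->
    (forall z, z \in l -> F z) ->
  ~ ale [set y | forall z, z \in l -> cent z y] A.
Proof.
move=> nale lF aK; have [I [iI [k Ik] lI]] := fitting_seq lF.
apply: nale; pose J : set g := [set` l].
have aJ j : ale (ann J j A) A.
  elim: j => [|j IH]; first by apply: ale_refl => //; exact: zA.1.
  apply: ale_trans aK; apply: ale_cap_seq => z zl; split; first exact: cent_zsub.
  by apply: (ale_hom zA (brBr z)) IH => v; apply.
apply: ale_sub (aJ k) => //; rewrite -Ik; apply: ann_sub => // _ ->.
exact: zA.1.
Qed.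

(** Each term of the iteration keeps the elements that g brackets into the previous term. The
    intersection of all terms would be an ideal but need not be definable; as infinite indices lower
    the dimension, some step has finite index, which is what [acent_ideal] requires. *)
Lemma almost_ideal H : zsub H -> defg H -> F `<=` H ->
  exists H1 H2, [/\ zsub H1 /\ defg H1, F `<=` H1, H1 `<=` H,
    H2 `<=` H1 /\ ale H1 H2 & forall x y, H2 x -> H1 (br y x)].
Proof.
move=> zH dH FH; pose next K : set g := K `&` [set x | forall y, K (br y x)].
pose Hs k := iter k next H.
have zHs k : zsub (Hs k).
  elim: k => //= k IH; split; first by split=> [|y]; rewrite ?br0r; exact: IH.1.
  move=> x x' [Kx Kbx] [Kx' Kbx']; split=> [|y]; first exact: IH.2.
  by rewrite brBr; exact: IH.2.
have dHs k : defg (Hs k).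
  elim: k => //= k IH; apply: (defg_cap iotaI drange) => //.
  apply: (defg_gdef iotaI drange).
  apply: (gdef_all drange (R := fun w => Hs k (br (w None) (w (Some tt))))).
  by apply: (gdef_mem iotaI drange IH); apply: gfun_br; exact: gfun_var.
have FHs k : F `<=` Hs k.
  elim: k => //= k IH x Fx; split=> [|y]; apply: IH => //.
  exact: (fitting_ideal g).2.
have HsH k : Hs k `<=` H by elim: k => //= k IH x [/IH].
have [k kP] : exists k, ale (Hs k) (Hs k.+1).
  apply: contrapT => no.
  have drop k : (nd (Hs k.+1) < nd (Hs k))%N.
    by apply: (nd_lt dimP MT iotaI drange dadd) => // [x []//|a]; apply: no; exists k.
  have bound k : (nd (Hs k) + k <= nd H)%N.
    elim: k => [|k IH]; first by rewrite addn0.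
    by have := drop k; lia.
  by have := bound (nd H).+1; lia.
exists (Hs k), (Hs k.+1); split=> //; first by split=> // x [].
by move=> x y [_]; apply.
Qed.

(** Two brackets are needed: the first, with [P], carries [B] into an ideal [N] that is finite
    modulo [A]; the second, with the annihilator of [N], carries [N] into [A]. Intersecting with
    this annihilator costs only a finite index. *)
Lemma central_extension : ~ ale setT A -> exists B E,
  [/\ ideal B /\ defg B, A `<=` B /\ ~ ale B A, ideal E /\ defg E, ale F E
    & B `<=` ann E 2 A].
Proof.
move=> nale.
have [l [d [lF lP]]] := centralizer_chain setT F.
pose K := [set y | forall z, z \in l -> cent z y].
have zK : zsub K := cent_seq_zsub l.
have dK : defg K := defg_cent_seq l.
have nK : ~ ale K A := centralizer_not_small nale lF.
have FK : F `<=` acent K.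
  move=> x /lP /alen_ale; apply: ale_sub => // y Ky; by split.
have [H1 [H2 [[zH1 dH1] FH1 H1K [H21 aH] brH]]] :=
  almost_ideal (acent_zsub K) (defg_acent zK dK) FK.
pose K1 := acent H1.
have iK1 : ideal K1 := acent_ideal zH1 H21 aH brH.
have dK1 : defg K1 := defg_acent zH1 dH1.
have aK1 : ale K K1 := acent_symmetry zH1 dH1 zK dK H1K.
pose P := acent K1.
have iP : ideal P.
  apply: (acent_ideal iK1.1 (H' := K1)) => // [|x y]; last exact: iK1.2.
  by apply: ale_refl => //; exact: iK1.1.1.
have dP : defg P := defg_acent iK1.1 dK1.
have aH1P : ale H1 P := acent_symmetry iK1.1 dK1 zH1 dH1 (fun _ => id).
have aK1P : ale K1 (acent P) := acent_symmetry iP.1 dP iK1.1 dK1 (fun _ => id).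
(* The factor [K1] makes [P] almost centralize [B], the factor [acent P] gives the converse. By
   symmetry [B] still has finite index in [K1], hence is infinite modulo [A]. *)
pose B := K1 `&` acent P.
have iaP : ideal (acent P).
  apply: (acent_ideal iP.1 (H' := P)) => // [|x y]; last exact: iP.2.
  by apply: ale_refl => //; exact: iP.1.1.
have iB : ideal B.
  split; first split.
  - by split; [exact: iK1.1.1|exact: iaP.1.1].
  - by move=> x y [? ?] [? ?]; split; [exact: iK1.1.2|exact: iaP.1.2].
  - by move=> x y [? ?]; split; [exact: iK1.2|exact: iaP.2].
have dB : defg B by apply: (defg_cap iotaI drange) => //; apply: defg_acent => //; exact: iP.1.
have aK1B : ale K1 B.
  apply: ale_capI => //; [exact: iK1.1|exact: iaP.1|].
  by apply: ale_refl => //; exact: iK1.1.1.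
have [N [iN aN AN PBN]] := bracket_finite_ideal iP iB
  (acent_sub (fun x (Bx : B x) => Bx.1)) (fun x (Bx : B x) => Bx.2).
have dN : defg N := defg_ale dA iN.1 AN aN.
have iQ := annihilator_ideal iN.
exists B, (P `&` annihilator N); split.
- by [].
- split; first by move=> x Ax; split; exact: ideal_sub_acent.
  by move=> aB; apply: nK; exact: ale_trans aK1 (ale_trans aK1B aB).
- split; last by apply: (defg_cap iotaI drange) => //; exact: defg_annihilator.
  split; first split.
  + by split; [exact: iP.1.1|exact: iQ.1.1].
  + by move=> x y [? ?] [? ?]; split; [exact: iP.1.2|exact: iQ.1.2].
  + by move=> x y [? ?]; split; [exact: iP.2|exact: iQ.2].
- apply: ale_capI; [exact: iP.1|exact: iQ.1|exact: ale_sub aH1P|].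
  by apply: ale_sub (ale_annihilator iN AN aN).
- by move=> v Bv x [Px _] y [_ Qy]; apply: Qy; exact: PBN.
Qed.

End ModuloIdeal.

(** * Ideals killed by repeated brackets with an ideal almost containing F(g) *)

Definition good A := [/\ ideal A, defg A & exists E,
  [/\ ideal E, defg E, ale F E & exists k, A `<=` ann E k [set 0]]].

Lemma good0 : good [set 0].
Proof.
split; [exact: ideal0|exact: defg_set1|exists setT; split].
- by split.
- exact: drange.
- exact: ale_refl.
- by exists 0%N.
Qed.

Lemma idealI E E' : ideal E -> ideal E' -> ideal (E `&` E').
Proof.
move=> iE iE'; split; first split.
- by split; [exact: iE.1.1|exact: iE'.1.1].
- by move=> x y [? ?] [? ?]; split; [exact: iE.1.2|exact: iE'.1.2].
- by move=> x y [? ?]; split; [exact: iE.2|exact: iE'.2].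
Qed.

(** The acting ideals are intersected and the brackets add up: two carry [B] into [A], and [k] more
    carry [A] to 0. *)
Lemma good_step A : good A -> ~ ale setT A ->
  exists B, [/\ good B, A `<=` B & ~ ale B A].
Proof.
move=> [iA dA [E [iE dE aE [k Ak]]]] /(central_extension iA dA).
move=> [B [E' [[iB dB] [AB nBA] [iE' dE'] aE' BE']]].
exists B; split=> //; split=> //; exists (E `&` E'); split.
- exact: idealI.
- exact: (defg_cap iotaI drange).
- by apply: ale_capI => //; [exact: iE.1|exact: iE'.1].
exists (2 + k)%N; rewrite -ann_add => v /BE'.
apply: ann_sub; first by move=> x [].
by move=> x /Ak; apply: ann_sub => // y [].
Qed.

Lemma good_almost_full : exists2 A, good A & ale setT A.
Proof.
suff key k A : good A -> (nd setT - nd A <= k)%N -> exists2 A, good A & ale setT A.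
  exact: key good0 (leqnn _).
elim: k A => [|k IH] A gA Ak; have [|/(good_step gA)[B [gB AB nBA]]] := pselect (ale setT A).
- by exists A.
- have [iA dA _] := gA; have [iB dB _] := gB.
  have := nd_lt dimP MT iotaI drange dadd dB dA iB.1 iA.1 AB nBA.
  have : (nd B <= nd setT)%N by apply: (nd_mono dimP MT iotaI drange).
  lia.
- by exists A.
- have [iA dA _] := gA; have [iB dB _] := gB.
  apply: (IH B gB).
  have := nd_lt dimP MT iotaI drange dadd dB dA iB.1 iA.1 AB nBA.
  lia.
Qed.

(** As g is finite modulo [A], the elements that bracket all of g into [A] form an ideal of finite
    index. One bracket with it leads from g to [A] and [k] more to 0, whence [k.+1]. *)
Lemma nilpotent_almost_fitting : exists E, [/\ ideal E, defg E, adnil E & ale F E].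
Proof.
have [A [iA dA [E [iE dE aE [k Ak]]]] aA] := good_almost_full.
have iT : ideal [set: g] by split.
have iQ := annihilator_ideal iA iT.
exists (E `&` annihilator A setT); split.
- exact: idealI.
- by apply: (defg_cap iotaI drange) => //; apply: defg_annihilator => //; exact: drange.
- exists k.+1; apply/seteqP; split=> // v _ x [_ Qx].
  apply: (ann_sub (@subIsetl _ E (annihilator A setT)) (@subset_refl _ [set 0])).
  by apply: Ak; exact: Qx.
- apply: ale_capI => //; [exact: iE.1|exact: iQ.1|].
  by apply: ale_sub (ale_annihilator iA iT _ aA).
Qed.

Lemma fitting_nilpotent_definable : nilpotent F /\ defg F.
Proof.
have [E [iE dE nE [s sc]]] := nilpotent_almost_fitting.
have iF := fitting_ideal g.
have EF : E `<=` F by move=> x Ex; rewrite fittingE; exists E.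
split; last by apply: (defg_ale dE iF.1 EF); exists s.
apply/nilpotent_adnil => //.
have [|I [iI nI sI]] := @fitting_seq g [seq r <- s | `[< F r >]].
  by move=> r; rewrite mem_filter => /andP[/asboolP].
have -> : F = sumset E I; last exact: sumset_adnil.
apply/seteqP; split=> x.
  move=> Fx; have [r rs Er] := sc x Fx; exists (x - r) => //.
  exists r; last by rewrite subrK.
  apply: sI; rewrite mem_filter rs andbT; apply/asboolP.
  by rewrite -(subKr x r); apply: iF.1.2 => //; exact: EF.
move=> [y Ey [z Iz ->]]; apply: (zsubD iF.1); first exact: EF.
by rewrite fittingE; exists I.
Qed.

End Fitting.

Theorem theorem8p11 (L : language) (T : theory L) (M : structure L)
    (g : lieRing) (n : nat) (iota : g -> n.-tuple M)
    (Tfd : finite_dimensional T) (MT : models M T)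
    (gdef : definable_lie iota) :
  nilpotent (fitting g) /\ definable (iota @` fitting g).
Proof. by have [dim dimP] := Tfd; exact: (fitting_nilpotent_definable dimP MT gdef). Qed.
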